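(* For $n=2$, the invariant set $\mathcal C^-=\{\bar\xi\in\mathcal C:k\bar s<0\}$ is locally asymptotically stable, whereas $\mathcal C^+=\{\bar\xi\in\mathcal C:k\bar s>0\}$ is unstable; i.e., the formation of counterclockwise circular formations is locally asymptotically stable when $k<0$ and unstable when $k>0$, and the opposite holds for the formation of clockwise circular formations.
   Context: Let $n=2$, $v>0$, $k\ne0$, indices modulo $n$. State $\xi=[\xi_1^\top,\ldots,\xi_n^\top]^\top\in\mathbb R^{3n}$ with $\xi_i=[\rho_i,\alpha_i,\beta_i]^\top$, $\rho_i>0$ (relative coordinates of $n$ unicycles of fixed forward speed $v$ in cyclic pursuit without overlap: $\rho_i$ distance from $i$ to $i+1$, $\alpha_i$ the bearing of $i+1$ from $i$'s heading, $\beta_i=\theta_i-\theta_{i+1}-\pi$ with $\theta_i$ the headings). Angles are understood modulo $2\pi$ and normalized to $[-\pi,\pi)$ whenever necessary. The closed-loop system $\dot\xi=\hat f(\xi)$ is $$\dot\rho_i=-v(\cos\alpha_i+\cos(\alpha_i+\beta_i)),$$ $$\dot\alpha_i=\tfrac{v}{\rho_i}(\sin(\alpha_i+\beta_i)-\sin\alpha_i)-\tfrac{k}{\rho_i}(\cos\alpha_i+\cos(\alpha_i+\beta_i)),$$ $$\dot\beta_i=\omega_i-\omega_{i+1},\qquad \omega_i=\tfrac{2v}{\rho_i}\sin\alpha_i+\tfrac{k}{\rho_i}(\cos\alpha_i+\cos(\alpha_i+\beta_i)).$$ $\mathcal M=\{\xi\in\mathbb R^{3n}: g(\xi)=0\}$,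 where $g=[g_1,g_2,g_3]^\top$ and, with $\gamma_i=(i-1)\pi-\sum_{j=1}^{i-1}\beta_j$, $g_1=\sum_i\rho_i\sin(\alpha_i+\gamma_i)$, $g_2=\sum_i\rho_i\cos(\alpha_i+\gamma_i)$, $g_3=\sum_i\beta_i+n\pi$ (the last equation taken modulo $2\pi$). The system evolves on $\mathcal M$. The set of equilibria is $\Xi=\{\bar\xi\in\mathcal M: 2\bar\alpha_i+\bar\beta_i=\pi\bmod 2\pi$ and $\exists\bar s$ s.t. $\sin\bar\alpha_i/\bar\rho_i=\bar s$ for all $i\}$, $\bar s=\bar s(\bar\xi)$ denotes this common value, and $\mathcal C=\{\bar\xi\in\Xi:\bar s\neq0\}$. Each $\bar\xi\in\mathcal C$ corresponds to a circular formation (all unicycles traveling along a common circle at the same angular speed), counterclockwise if $\bar s>0$ and clockwise if $\bar s<0$. A set $S\subset\mathcal M$ of equilibria is locally asymptotically stable if there is a sufficiently small $\delta>0$ such that $\xi(0)\in\mathcal M$, $\operatorname{dist}(\xi(0),S)<\delta$ imply $\lim_{t\to\infty}\operatorname{dist}(\xi(t),S)=0$, where $\operatorname{dist}(\xi,S)=\inf_{\bar\xi\in S}\|\xi-\bar\xi\|$. ''Unstable'' has its standard meaning for invariant sets (not Lyapunov stable).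
   Formalization: Local asymptotic stability is proved with δ depending on the point of the set: no uniform δ works, since equilibria of C^+ with s̄ near 0 lie arbitrarily close to C^-. ''Unstable'' negates Lyapunov stability with such pointwise δ, which implies the uniform version. *)

(* Defs.v *)
From HB Require Import structures.
From mathcomp Require Import all_boot all_order all_algebra.
From mathcomp Require Import all_classical all_reals all_analysis.

Set Implicit Arguments.
Unset Strict Implicit.
Unset Printing Implicit Defensive.

Import Order.TTheory GRing.Theory Num.Theory.
Import numFieldNormedType.Exports.

Local Open Scope classical_set_scope.
Local Open Scope ring_scope.

Section CyclicPursuit.
Variables (R : realType) (n : nat).

(* R^(3n), written with the block xi_i = [rho_i, alpha_i, beta_i] as i-th row.
   Angles are kept as real numbers; every set below is invariant under adding
   multiples of 2 pi to any alpha_i or beta_i, so that the distance to such a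
   set is the distance computed with angles modulo 2 pi. *)
Definition state := 'M[R]_(n, 3).

Definition rho (x : state) (i : 'I_n) : R := x i 0.
Definition alpha (x : state) (i : 'I_n) : R := x i 1.
Definition beta (x : state) (i : 'I_n) : R := x i 2.

Definition eqmod2pi (a b : R) : Prop := exists m : int, a - b = m%:~R * (2 * pi).

Definition cos_sum (x : state) (i : 'I_n) : R :=
  cos (alpha x i) + cos (alpha x i + beta x i).

Definition omega (v k : R) (x : state) (i : 'I_n) : R :=
  2 * v / rho x i * sin (alpha x i) + k / rho x i * cos_sum x i.

Definition rho_rhs (v : R) (x : state) (i : 'I_n) : R := - v * cos_sum x i.

Definition alpha_rhs (v k : R) (x : state) (i : 'I_n) : R :=
  v / rho x i * (sin (alpha x i + beta x i) - sin (alpha x i))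
  - k / rho x i * cos_sum x i.

Definition beta_rhs (v k : R) (x : state) (i : 'I_n) : R :=
  omega v k x i - omega v k x (ordS i).

(* A solution on [0, +oo[ staying in the domain rho_i > 0; values of xi at
   negative times are irrelevant. *)
Definition is_solution (v k : R) (xi : R -> state) : Prop :=
  [/\ forall (t : R) i, 0 <= t -> 0 < rho (xi t) i,
      {within `[0, +oo[, continuous xi} &
      forall (t : R) i, 0 < t ->
        [/\ is_derive t (1 : R) (fun s => rho (xi s) i) (rho_rhs v (xi t) i),
            is_derive t (1 : R) (fun s => alpha (xi s) i) (alpha_rhs v k (xi t) i) &
            is_derive t (1 : R) (fun s => beta (xi s) i) (beta_rhs v k (xi t) i)]].

(* With indices starting at 0, (i - 1) pi becomes i pi. *)
Definition gamma (x : state) (i : 'I_n) : R :=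
  i%:R * pi - \sum_(j < n | (j < i)%N) beta x j.

Definition manifold : set state :=
  [set x | [/\ forall i, 0 < rho x i,
               \sum_(i < n) rho x i * sin (alpha x i + gamma x i) = 0,
               \sum_(i < n) rho x i * cos (alpha x i + gamma x i) = 0 &
               eqmod2pi (\sum_(i < n) beta x i + n%:R * pi) 0]].

Definition common_s (x : state) (s : R) : Prop :=
  forall i, sin (alpha x i) / rho x i = s.

Definition equilibria : set state :=
  [set x | [/\ manifold x,
               forall i, eqmod2pi (2 * alpha x i + beta x i) pi &
               exists s, common_s x s]].

Definition circular : set state :=
  [set x | equilibria x /\ exists2 s, common_s x s & s != 0].

Definition circular_neg (k : R) : set state :=
  [set x | circular x /\ exists2 s, common_s x s & k * s < 0].

Definition circular_pos (k : R) : set state :=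
  [set x | circular x /\ exists2 s, common_s x s & 0 < k * s].

Definition counterclockwise : set state :=
  [set x | circular x /\ exists2 s, common_s x s & 0 < s].

Definition clockwise : set state :=
  [set x | circular x /\ exists2 s, common_s x s & s < 0].

Definition enorm (x : state) : R :=
  Num.sqrt (\sum_(i < n) \sum_(j < 3) x i j ^+ 2).

Definition dist (x : state) (S : set state) : R :=
  inf [set enorm (x - y) | y in S].

(* P holds for all initial states in the manifold sufficiently close to S.  The
   radius may depend on the point of S, as in Bhatia and Szego's definitions of
   stable and (semi-)attracting sets; for compact S this is the same as a
   uniform radius.  The sets considered here are not compact, and no uniform
   radius can work for n = 2: the closures of the counterclockwise and of the
   clockwise circular formations meet (at equilibria with s = 0), so every
   uniform neighbourhood of one contains equilibria of the other. *)
Definition near_set (S : set state) (P : state -> Prop) : Prop :=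
  forall y, S y -> exists2 delta : R, 0 < delta &
    forall x, manifold x -> enorm (x - y) < delta -> P x.

Definition locally_asymptotically_stable (v k : R) (S : set state) : Prop :=
  near_set S (fun x =>
    (exists2 xi, is_solution v k xi & xi 0 = x) /\
    forall xi, is_solution v k xi -> xi 0 = x ->
      dist (xi t) S @[t --> +oo] --> (0 : R)).

Definition lyapunov_stable (v k : R) (S : set state) : Prop :=
  forall eps : R, 0 < eps -> near_set S (fun x =>
    forall xi, is_solution v k xi -> xi 0 = x ->
      forall t : R, 0 <= t -> dist (xi t) S < eps).

Definition unstable (v k : R) (S : set state) : Prop := ~ lyapunov_stable v k S.

End CyclicPursuit.

Arguments circular_neg {R} n k.
Arguments circular_pos {R} n k.

(* Main.v *)
(* On the constraint manifold rho_2 = rho_1, alpha_2 = alpha_1 + beta_1 and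
   beta_2 = - beta_1 (mod 2 pi).  With sigma = alpha_1 + beta_1 / 2 and
   delta = - beta_1 / 2 the closed loop becomes
     rho'   = - 2 v cos sigma cos delta,
     sigma' = - (2 k / rho) cos sigma cos delta,
     delta' = - (2 v / rho) cos sigma sin delta,
   so that sigma - (k / v) ln rho and sin delta / rho are conserved and the
   equilibria are given by cos sigma = 0, with s = sin sigma cos delta / rho.
   Writing sigma = sb + u with cos sb = 0 gives
     u' = (2 / rho) (k sin sb cos delta) sin u,
   and the conserved quantities keep the sign of cos delta.  Hence u tends to 0
   when k sin sb cos delta < 0, which is the condition k s < 0, and the distance
   to C^- is at most 2 |u| since shifting both alpha_i by - u lands in C^-.
   For instability, start with delta = 0 and sigma slightly inside the interval
   between an unstable zero of cos sigma and the neighbouring stable one: u tends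
   to 0 with respect to the latter, where k sin alpha_1 is negative, whereas
   k sin alpha_1 is positive on C^+. *)
Require Import Defs.
From HB Require Import structures.
From mathcomp Require Import all_boot all_order all_algebra.
From mathcomp Require Import all_classical all_reals all_analysis.
From mathcomp Require Import ring lra.

Set Implicit Arguments.
Unset Strict Implicit.
Unset Printing Implicit Defensive.

Import Order.TTheory GRing.Theory Num.Theory.
Import numFieldNormedType.Exports.

Local Open Scope classical_set_scope.
Local Open Scope ring_scope.

(** * One-sided evolution of real functions *)

Section Evolution.
Context {R : realType}.
Implicit Types (f g df dg : R -> R) (t c : R).

(* Solutions are only required to be continuous at [t = 0], so monotonicity and
   conservation laws are derived from this one-sided notion. *)
Definition evolves f df : Prop :=
  {within `[0, +oo[, continuous f} /\
  forall t, 0 < t -> is_derive t (1 : R) f (df t).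

Lemma evolves_cst (c : R) : evolves (fun=> c) (fun=> 0).
Proof.
split; first by apply: continuous_subspaceT => x; exact: cvg_cst.
by move=> t _; exact: is_derive_cst.
Qed.

Lemma evolvesD f df g dg : evolves f df -> evolves g dg ->
  evolves (fun t => f t + g t) (fun t => df t + dg t).
Proof.
move=> [cf hf] [cg hg]; split=> [x|t t0]; first exact: cvgD (cf x) (cg x).
by have := hf _ t0; have := hg _ t0 => ? ?; exact: is_deriveD.
Qed.

Lemma evolvesM f df g dg : evolves f df -> evolves g dg ->
  evolves (fun t => f t * g t) (fun t => df t * g t + f t * dg t).
Proof.
move=> [cf hf] [cg hg]; split=> [x|t t0]; first exact: cvgM (cf x) (cg x).
have := hf _ t0; have := hg _ t0 => ? ?.
by apply: is_derive_eq; rewrite addrC /GRing.scale /= mulrC.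
Qed.

(** Agreement at nonnegative times suffices: continuity is taken within that half-line, and a
    positive time has a neighbourhood inside it. *)
Lemma evolves_eq f df g dg : evolves f df ->
  (forall t, 0 <= t -> f t = g t) -> (forall t, 0 < t -> df t = dg t) ->
  evolves g dg.
Proof.
move=> [cf hf] fg dfg; split.
  apply: (@subspace_eq_continuous _ _ _ f) => // t; rewrite inE /= in_itv /= andbT.
  exact: fg.
move=> t t0; rewrite -dfg //; apply: (near_eq_is_derive _ (hf _ t0)) => //.
by near=> s; rewrite fg // ltW //; near: s; exact: lt_nbhsr.
Unshelve. all: by end_near. Qed.

(** Differentiability of [h] is asked only at the values of [f], which admits the inverse and the
    arcsine, smooth on part of the line only. *)
Lemma evolves_comp f df (h dh : R -> R) : evolves f df ->
  (forall t, 0 <= t -> is_derive (f t) 1 h (dh (f t))) ->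
  evolves (fun t => h (f t)) (fun t => dh (f t) * df t).
Proof.
move=> [cf hf] hh; split=> [|t t0]; last first.
  exact: (is_derive1_comp (hh _ (ltW t0)) (hf _ t0)).
apply/subspace_continuousP => t /=; rewrite in_itv /= andbT => t0.
move/subspace_continuousP : cf => /(_ t); rewrite /= in_itv /= t0 => /(_ isT) cf.
have ch : {for f t, continuous h}.
  apply: differentiable_continuous.
  by apply/derivable1_diffP; case: (hh t t0).
exact: (cvg_comp _ _ cf ch).
Qed.

Lemma evolves_derive (f df : R -> R) :
  (forall t : R, 0 <= t -> is_derive t (1 : R) f (df t)) -> evolves f df.
Proof.
move=> hf; split; last by move=> t /ltW; exact: hf.
apply: continuous_in_subspaceT => t; rewrite inE /= in_itv /= andbT => /hf dt.
apply: differentiable_continuous.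
by apply/derivable1_diffP; case: dt.
Qed.

Lemma evolvesZ c f df : evolves f df ->
  evolves (fun t => c * f t) (fun t => c * df t).
Proof.
move=> ef; apply: evolves_eq (evolvesM (evolves_cst c) ef) _ _ => // t _.
by rewrite mul0r add0r.
Qed.

Lemma evolvesDc c f df : evolves f df -> evolves (fun t => f t + c) df.
Proof.
move=> ef; apply: evolves_eq (evolvesD ef (evolves_cst c)) _ _ => // t _.
by rewrite addr0.
Qed.

Lemma evolves_sin f df : evolves f df ->
  evolves (fun t => sin (f t)) (fun t => cos (f t) * df t).
Proof.
by move=> ef; apply: (evolves_comp ef (dh := cos)) => t _; exact: is_derive_sin.
Qed.

Lemma evolves_cos f df : evolves f df ->
  evolves (fun t => cos (f t)) (fun t => - sin (f t) * df t).
Proof.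
move=> ef; apply: (evolves_comp ef (dh := fun x => - sin x)) => t _.
Qed.

Lemma evolves_expR f df : evolves f df ->
  evolves (fun t => expR (f t)) (fun t => expR (f t) * df t).
Proof.
by move=> ef; apply: (evolves_comp ef (dh := expR)) => t _; exact: is_derive_expR.
Qed.

Lemma evolvesV f df : evolves f df -> (forall t, 0 <= t -> 0 < f t) ->
  evolves (fun t => (f t)^-1) (fun t => - (f t) ^- 2 * df t).
Proof.
move=> ef f0; apply: (evolves_comp ef (h := fun x => x^-1) (dh := fun x => - x ^- 2)).
move=> t /f0 ft; have := @is_deriveV R id (f t) 1 1.
rewrite /GRing.scale /= mulr1; apply; first by rewrite gt_eqF.
Qed.

Lemma evolves_id : evolves (fun t : R => t) (fun=> 1).
Proof.
split; first by apply: continuous_subspaceT => x; exact: cvg_id.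
by move=> t _; exact: is_derive_id.
Qed.

Lemma evolves_at f df t : evolves f df -> 0 <= t ->
  {within `[0, t], continuous f}.
Proof.
move=> [cf _] t0; apply: continuous_subspaceW cf => x /=.
by rewrite !in_itv /= andbT => /andP[].
Qed.

Lemma evolves_le f df t : evolves f df -> 0 <= t ->
  (forall s, 0 < s < t -> df s <= 0) -> f t <= f 0.
Proof.
rewrite le0r => ef /predU1P[-> //|t0] dle.
have [||s] := @MVT R f df 0 t t0.
- by move=> s; rewrite in_itv /= => /andP[s0 _]; exact: ef.2.
- exact: evolves_at ef (ltW t0).
rewrite in_itv /= => /dle ds E; rewrite -subr_le0 E subr0.
by rewrite mulr_le0_ge0 // ltW.
Qed.

Lemma evolves_const f df t : evolves f df -> 0 <= t ->
  (forall s, 0 < s < t -> df s = 0) -> f t = f 0.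
Proof.
move=> ef t0 d0; apply/le_anti/andP; split.
  by apply: (evolves_le ef) => // s /d0 ->.
have eN := evolvesM (evolves_cst (-1)) ef.
have := evolves_le eN t0; rewrite !mulN1r lerN2; apply=> s /d0 ->.
by rewrite mul0r mulr0 addr0.
Qed.

Lemma evolves_sign f df t : evolves f df -> 0 <= t ->
  (forall s, 0 <= s <= t -> f s != 0) -> f 0 < 0 -> f t < 0.
Proof.
move=> ef t0 fn f0; rewrite ltNge; apply/negP => ft.
have [|s] := @IVT R f 0 t 0 t0 (evolves_at ef t0).
  by rewrite ge_min le_max (ltW f0) ft orbT.
by rewrite in_itv /= => /fn /eqP.
Qed.

(** Bootstrap on the infimum [m] of the times at which [f] is at least [r]: [f <= r] up to [m], so
    the hypothesis gives [f m < r], and continuity extends this past [m], a contradiction. *)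
Lemma evolves_trap f df (r : R) : evolves f df -> f 0 < r ->
  (forall t, 0 <= t -> (forall s, 0 <= s <= t -> f s <= r) -> f t < r) ->
  forall t, 0 <= t -> f t < r.
Proof.
move=> ef f0 H t t0; rewrite ltNge; apply/negP => ft.
pose A := [set s | 0 <= s <= t /\ r <= f s].
have A0 : A !=set0 by exists t; split; rewrite ?t0 ?lexx.
have lA : has_lbound A by exists 0 => s [/andP[]].
have iA : has_inf A by [].
set m := inf A.
have m0 : 0 <= m by apply: lb_le_inf => // s [/andP[]].
have mt : m <= t by apply: ge_inf => //; split; rewrite ?t0 ?lexx.
have below s : 0 <= s -> s < m -> f s < r.
  move=> s0 sm; rewrite ltNge; apply/negP => rs.
  have : m <= s by apply: ge_inf => //; split=> //; rewrite s0 (le_trans _ mt) // ltW.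
  by rewrite leNgt sm.
have mle : f m <= r.
  move: m0; rewrite le0r => /predU1P[->|m0]; first exact: ltW.
  rewrite leNgt; apply/negP => rm.
  have := @IVT R f 0 m r (ltW m0) (evolves_at ef (ltW m0)).
  case; first by rewrite ge_min le_max (ltW f0) (ltW rm) orbT.
  move=> c; rewrite in_itv /= => /andP[c0 cm] fc.
  move: cm; rewrite le_eqVlt => /predU1P[cm|/(below _ c0)].
    by move: rm; rewrite -cm fc ltxx.
  by rewrite fc ltxx.
have mlt : f m < r.
  apply: H => // s /andP[s0]; rewrite le_eqVlt => /predU1P[-> //|sm].
  exact/ltW/below.
have [cf _] := ef.
move/subspace_continuousP : cf => /(_ m); rewrite /= in_itv /= m0 => /(_ isT) cf.
have : \forall s \near within `[0, +oo[ (nbhs m), f s < r.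
  exact: (cvgr_lt (f m)).
rewrite near_withinE => -[e /= e0 he].
have [s [/andP[s0 st] rs] sme] := inf_adherent e0 iA.
have : f s < r.
  apply: he; last by rewrite /= in_itv /= s0.
  have ms : m <= s by apply: ge_inf => //; split=> //; rewrite s0.
  rewrite -/m in sme; rewrite /= ltr_norml; apply/andP; split; lra.
by rewrite ltNge rs.
Qed.

End Evolution.

(** * Scalar autonomous equations *)

Section ScalarODE.
Context {R : realType}.

(** Integrating from [-1] makes the derivative at [0] two-sided, as needed to differentiate the
    inverse function at time [0]. *)
Lemma primitive_gtN1 (f : R -> R) : continuous f ->
  exists2 F : R -> R, F 0 = 0 &
    forall x : R, -1 < x -> is_derive x (1 : R) F (f x).
Proof.
move=> cf.
pose F x := Rintegral (@lebesgue_measure R) `[-1, x] f.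
exists (fun x => F x - F 0); first by rewrite subrr.
move=> x x1.
have intf : (@lebesgue_measure R).-integrable `[-1, x + 1] (EFin \o f).
  apply: continuous_compact_integrable; first exact: segment_compact.
  by apply: continuous_subspaceT => ?; exact: cf.
have [|||dF eF] := @continuous_FTC1_closed R f (-1) x (x + 1) _ intf.
- by rewrite ltrDl.
- exact: x1.
- exact: cf.
have : is_derive x (1 : R) F (f x) by apply: DeriveDef => //; rewrite -derive1E.
move=> HF; have := is_derive_cst (F 0) x (1 : R) => HC.
by apply: is_derive_eq; rewrite subr0.
Qed.

(* [z] is the inverse of the travel time, the primitive of [1 / b]. *)
Lemma scalar_ode (b : R -> R) (m M : R) : continuous b -> 0 < m ->
  (forall x, m <= b x <= M) ->
  exists2 z : R -> R, z 0 = 0 &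
    forall t, 0 <= t -> 0 <= z t /\ is_derive t (1 : R) z (b (z t)).
Proof.
move=> cb m0 mbM.
have b0 x : 0 < b x by rewrite (lt_le_trans m0) //; case/andP: (mbM x).
have M0 : 0 < M by rewrite (lt_le_trans (b0 0)) //; case/andP: (mbM 0).
have cV : continuous (fun x => (b x)^-1).
  by move=> x; apply: continuousV; [rewrite gt_eqF | exact: cb].
have [T T0 dT] := primitive_gtN1 cV.
have cT (x : R) : -1 < x -> {for x, continuous T}.
  move=> /dT dTx; apply: differentiable_continuous.
  by apply/derivable1_diffP; case: dTx.
have cTi (x y : R) : -1 < x -> {within `[x, y], continuous T}.
  move=> x1; apply: continuous_in_subspaceT => s; rewrite inE /= in_itv /=.
  by move=> /andP[xs _]; apply: cT; exact: lt_le_trans xs.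
have mvt (x y : R) : -1 < x -> x < y -> exists c, T y - T x = (b c)^-1 * (y - x).
  move=> x1 xy; have [||c _ E] := @MVT R T (fun x => (b x)^-1) x y xy.
  - by move=> s; rewrite in_itv /= => /andP[xs _]; apply: dT; exact: lt_trans xs.
  - exact: cTi.
  by exists c.
have Tlt (x y : R) : -1 < x -> x < y -> T x < T y.
  move=> x1 xy; have [c E] := mvt _ _ x1 xy; rewrite -subr_gt0 E mulr_gt0 //.
    by rewrite invr_gt0.
  by rewrite subr_gt0.
have Tinj (x y : R) : -1 < x -> -1 < y -> T x = T y -> x = y.
  move=> x1 y1 E; have [xy|yx|//] := ltgtP x y.
    by have := Tlt _ _ x1 xy; rewrite E ltxx.
  by have := Tlt _ _ y1 yx; rewrite E ltxx.
have Tsurj (t : R) : 0 <= t -> exists2 x, 0 <= x & T x = t.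
  rewrite le0r => /predU1P[->|t0]; first by exists 0.
  have tM0 : 0 < t * M by rewrite mulr_gt0.
  (* The slope of [T] is at least [1 / M], so [T] has reached [t] by [t * M]. *)
  have tT : t <= T (t * M).
    have [c E] := mvt 0 (t * M) (ltrN10 _) tM0.
    move: E; rewrite T0 !subr0 => ->.
    by rewrite ler_pdivlMl // mulrC ler_wpM2l // ?(ltW t0) //; case/andP: (mbM c).
  have [||x] := @IVT R T 0 (t * M) t (ltW tM0).
  - by apply: cTi; rewrite ltrN10.
  - by rewrite T0 ge_min le_max (ltW t0) tT orbT.
  by rewrite in_itv /= => /andP[x0 _] Tx; exists x.
(* [get] gives a default value outside the range of [T]; by [Tsurj] no [t >= 0] is affected. *)
pose z (t : R) := get [set x : R | -1 < x /\ T x = t].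
have zT (x : R) : -1 < x -> z (T x) = x.
  move=> x1; rewrite /z; case: xgetP => [y _ [y1 /Tinj]|/(_ x)]; first exact.
  by case.
exists z; first by rewrite -T0 zT // ltrN10.
move=> t /Tsurj[x x0 <-]; have x1 : -1 < x by rewrite (lt_le_trans _ x0) // ltrN10.
rewrite zT //; split=> //; rewrite -[b x]invrK.
apply: (@is_derive_inverse R T z (b x)^-1 x); last by rewrite invr_eq0 gt_eqF.
- by near=> y; apply: zT; near: y; exact: lt_nbhsr.
- by near=> y; apply: cT; near: y; exact: lt_nbhsr.
- exact: dT.
Unshelve. all: by end_near. Qed.

End ScalarODE.

(** * Trigonometry *)

Section Trigo.
Context {R : realType}.
Implicit Types a b u x r : R.

Lemma derive_bound_lipschitz (f df : R -> R) (K : R) :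
  (forall x, is_derive x (1 : R) f (df x)) -> (forall x, `|df x| <= K) ->
  forall x y, `|f x - f y| <= K * `|x - y|.
Proof.
move=> hf hK.
have le x y : x <= y -> `|f y - f x| <= K * `|y - x|.
  move=> xy; have [|c _ ->] := MVT_segment xy (fun s _ => hf s).
    apply: continuous_subspaceT => s; apply: differentiable_continuous.
    by apply/derivable1_diffP; case: (hf s).
  by rewrite normrM ler_wpM2r.
move=> x y; case: (leP x y) => [/le|/ltW/le //].
by rewrite distrC [X in K * X]distrC.
Qed.

Lemma sin_lipschitz x y : `|sin x - sin y| <= `|x - y|.
Proof.
rewrite -[leRHS]mul1r; apply: (@derive_bound_lipschitz sin cos) => s.
exact: cos_max.
Qed.

Lemma periodicz (f : R -> R) (T : R) : periodic f T ->
  forall (n : int) a, f (a + n%:~R * T) = f a.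
Proof.
move=> fT; case=> n a; first by rewrite -pmulrn mulr_natl periodicn.
rewrite NegzE mulrNz mulNr -pmulrn mulr_natl.
by rewrite -[in RHS](subrK (T *+ n.+1) a) periodicn.
Qed.

Lemma eqmod2pi_sin a b : eqmod2pi a b -> sin a = sin b.
Proof.
case=> n E; rewrite -(subrK b a) E addrC mulr_natl.
by rewrite (periodicz (@sinD2pi R)).
Qed.

Lemma eqmod2pi_cos a b : eqmod2pi a b -> cos a = cos b.
Proof.
case=> n E; rewrite -(subrK b a) E addrC mulr_natl.
by rewrite (periodicz (@cosD2pi R)).
Qed.

(** Let [x] in [[0, 2 * pi)] be the remainder of [a - b]. From [cos x = 1] follows
    [sin (x / 2) = 0], while [sin] is positive on [(0, pi)]; so [x = 0]. *)
Lemma cos_eq1_eqmod2pi a b : cos (a - b) = 1 -> eqmod2pi a b.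
Proof.
move=> c1; have pi0 : 0 < (2 * pi : R) by rewrite mulr_gt0 // pi_gt0.
pose n := Num.floor ((a - b) / (2 * pi)).
exists n; pose x := a - b - n%:~R * (2 * pi).
have /andP[n1 n2] : n%:~R <= (a - b) / (2 * pi) < (n + 1)%:~R.
  by rewrite Num.Theory.floor_le /= Num.Theory.floorD1_gt.
have x0 : 0 <= x by rewrite subr_ge0 -ler_pdivlMr.
have x2 : x < 2 * pi.
  by move: n2; rewrite ltr_pdivrMr // intrD mulrDl mul1r /x; lra.
have cx : cos x = 1.
  rewrite -c1 /x -[X in cos X = _]addr0 -(periodicz (@cosD2pi R) n).
  by rewrite addr0 mulr_natl subrK.
have : sin (x / 2) = 0.
  apply/eqP; rewrite -sqrf_eq0.
  have := cos_mulr2n (x / 2); rewrite -[x / 2 *+ 2]mulr_natr divfK // cx sin2cos2.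
  by rewrite -mulr_natr => E; apply/eqP; lra.
apply: contra_eqP => /eqP xn.
have {}x0 : 0 < x.
  by rewrite lt_neqAle x0 andbT; apply: contraNneq xn => E; rewrite -subr_eq0 -/x -E.
rewrite gt_eqF // sin_gt0_pi // divr_gt0 //=.
by rewrite ltr_pdivrMr // mulrC.
Qed.

Lemma cos_norm_le x r : 0 <= r -> `|x| <= r -> r <= pi -> cos r <= cos x.
Proof.
move=> r0 xr rpi; rewrite -(cos_norm x).
by rewrite le_eqVlt; have [->|nx] := eqVneq (cos r) (cos `|x|) => //=;
  rewrite ltr_cos ?in_itv /= ?normr_ge0 ?r0 ?(le_trans xr) // lt_neqAle xr
    andbT; apply: contraNneq nx => ->.
Qed.

Lemma sin_mul2atan x : sin (2 * atan x) = 2 * x / (1 + x ^+ 2).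
Proof.
have h : 0 < 1 + x ^+ 2 by rewrite ltr_wpDr // sqr_ge0.
have c := cos_atan x; have cn : cos (atan x) != 0 by rewrite c invr_eq0 sqrtr_eq0 -ltNge.
have e : cos (atan x) ^+ 2 = (1 + x ^+ 2)^-1 by rewrite c exprVn sqr_sqrtr // ltW.
rewrite mulr_natl sin_mulr2n.
have -> : sin (atan x) = x * cos (atan x).
  by rewrite -[X in _ = X * _](atanK x) /tan divfK.
by rewrite mulrCA -expr2 e -mulr_natl mulrA.
Qed.

End Trigo.

(** * The reduced system *)

Section Reduced.
Context {R : realType}.
Variables v k : R.
Hypotheses (v0 : 0 < v) (k0 : k != 0).
Implicit Types (p s d : R -> R) (t sb r : R).

(** The closed loop on the constraint manifold, with [p], [s], [d] standing for rho, sigma,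
    delta. *)
Definition pursuit p s d : Prop :=
  [/\ forall t, 0 <= t -> 0 < p t,
      evolves p (fun t => - (2 * v) * cos (s t) * cos (d t)),
      evolves s (fun t => - (2 * k) / p t * cos (s t) * cos (d t)) &
      evolves d (fun t => - (2 * v) / p t * cos (s t) * sin (d t))].

(** The first conservation law in exponential form: [p * expR (- (v / k) * s)] has zero
    derivative. *)
Lemma pursuit_rho p s d t : pursuit p s d -> 0 <= t ->
  p t = p 0 * expR (v / k * (s t - s 0)).
Proof.
move=> [p0 ep es ed] t0.
have := evolvesM ep (evolves_expR (evolvesZ (- (v / k)) es)).
move=> /evolves_const/(_ t0) => H.
have -> : v / k * (s t - s 0) = - (v / k) * s 0 - (- (v / k) * s t) by ring.
rewrite expRD expRN mulrA -H ?mulfK // ?gt_eqF ?expR_gt0 // => x /andP[x0 _].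
by have px := p0 _ (ltW x0); field; rewrite k0 gt_eqF.
Qed.

Lemma pursuit_sin p s d t : pursuit p s d -> 0 <= t ->
  sin (d t) * p 0 = sin (d 0) * p t.
Proof.
move=> [p0 ep es ed] t0.
have := evolvesM (evolves_sin ed) (evolvesV ep p0).
move=> /evolves_const/(_ t0) => H.
have pn x : 0 <= x -> p x != 0 by move=> /p0 /gt_eqF ->.
apply/eqP; rewrite -eqr_div ?pn //; apply/eqP.
apply: H => x /andP[/ltW x0 _].
by field; rewrite pn.
Qed.

(** * Trapping and decay around an angle [sb] with [cos sb = 0] *)

Section Basin.
Variables (p s d : R -> R) (sb r : R).
Hypotheses (H : pursuit p s d) (csb : cos sb = 0) (ur : `|s 0 - sb| < r)
  (rpi : r < pi) (ksd : k * sin sb * cos (d 0) < 0)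
  (dr : sin (d 0) ^+ 2 * expR (4 * r * (v / `|k|)) < 1).

(* While [|s t - sb| <= r], the first conserved quantity bounds [p t / p 0] by
   [expR (2 * r * (v / `|k|))], hence the second one bounds [sin (d t) ^+ 2] by
   [q]: this keeps [cos (d t)] away from [0]. *)
Let q := sin (d 0) ^+ 2 * expR (4 * r * (v / `|k|)).
Let Rm := p 0 * expR (2 * r * (v / `|k|)).

Lemma basin_rho t : 0 <= t -> `|s t - sb| <= r -> p t <= Rm.
Proof.
move=> t0 ut; case: (H) => p0 _ _ _.
rewrite (pursuit_rho H t0) /Rm ler_wpM2l ?(ltW (p0 _ _)) // ler_expR.
rewrite (le_trans (ler_norm _)) // normrM normf_div (gtr0_norm v0) mulrC.
rewrite ler_wpM2r ?divr_ge0 // ?(ltW v0) //.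
(* Both differences are at most [r] in absolute value, whence the factor [2 * r] in [Rm]. *)
have -> : s t - s 0 = (s t - sb) - (s 0 - sb) by ring.
by rewrite (le_trans (ler_normB _ _)) // mulr_natl mulr2n lerD // ltW.
Qed.

Lemma basin_cos2 t : 0 <= t -> `|s t - sb| <= r -> 1 - q <= cos (d t) ^+ 2.
Proof.
move=> t0 ut; have := basin_rho t0 ut; case: (H) => p0 _ _ _ pt.
have pp0 := p0 0 (lexx _); have ppt := p0 t t0.
rewrite cos2sin2 lerD2l lerN2.
have -> : sin (d t) = sin (d 0) * (p t / p 0).
  by rewrite mulrA -(pursuit_sin H t0) mulfK // gt_eqF.
rewrite exprMn ler_wpM2l ?sqr_ge0 //.
have -> : 4 * r * (v / `|k|) = 2 * r * (v / `|k|) + 2 * r * (v / `|k|) by ring.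
rewrite expRD -expr2 lerXn2r ?nnegrE ?expR_ge0 ?divr_ge0 ?(ltW pp0) ?(ltW ppt) //.
by rewrite ler_pdivrMr // mulrC.
Qed.

(** As [cos (d x) ^+ 2 >= 1 - q > 0] on the whole interval, the cosine never vanishes there and
    keeps its initial sign. *)
Lemma basin_cos t : 0 <= t -> (forall x, 0 <= x <= t -> `|s x - sb| <= r) ->
  k * sin sb * cos (d t) < 0.
Proof.
move=> t0 ux; case: (H) => p0 _ _ ed.
apply: (evolves_sign (evolvesZ (k * sin sb) (evolves_cos ed)) t0) => //.
move=> x xt; have [x0 _] := andP xt.
rewrite mulf_neq0 //.
  by apply: contraTneq ksd => ->; rewrite mul0r ltxx.
have := basin_cos2 x0 (ux _ xt); apply: contraTneq => ->.
by rewrite expr0n /= -ltNge subr_gt0.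
Qed.

(** This gap is the Lyapunov function: its derivative is a square times a factor with the sign of
    [k * sin sb * cos (d t)]. *)
Lemma evolves_cos_gap : evolves (fun t => 1 - cos (s t - sb))
  (fun t => 2 / p t * (k * sin sb * cos (d t)) * sin (s t - sb) ^+ 2).
Proof.
case: (H) => p0 _ es _.
have := evolvesDc 1 (evolvesZ (-1) (evolves_cos (evolvesDc (- sb) es))).
move=> /evolves_eq; apply=> t t0; first by ring.
have -> : cos (s t) = - sin sb * sin (s t - sb).
  by rewrite -[in LHS](subrK sb (s t)) cosD csb; ring.
by ring.
Qed.

(** While the deviation is at most [r], the gap does not increase, so
    [cos (s t - sb) >= cos (s 0 - sb) > cos r]; this excludes a deviation of exactly [r]. *)
Lemma basin_trap t : 0 <= t -> `|s t - sb| < r.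
Proof.
have r0 : 0 < r by exact: le_lt_trans ur.
have sqr_r (x : R) : x ^+ 2 < r ^+ 2 = (`|x| < r).
  by rewrite -real_normK ?num_real // ltr_pXn2r // nnegrE ltW.
have sqr_le (x : R) : x ^+ 2 <= r ^+ 2 = (`|x| <= r).
  by rewrite -real_normK ?num_real // ler_pXn2r // nnegrE ltW.
(* The square replaces the absolute value, which is not differentiable at [0]. *)
rewrite -sqr_r; move: t.
case: (H) => p0 _ es _; have es' := evolvesDc (- sb) es.
have eu : evolves (fun t => (s t - sb) ^+ 2) _ := evolvesM es' es'.
apply: (evolves_trap eu); first by rewrite sqr_r.
move=> t t0 ux; have {}ux x : 0 <= x <= t -> `|s x - sb| <= r.
  by rewrite -sqr_le; exact: ux.
rewrite sqr_r lt_neqAle ux ?t0 ?lexx // andbT.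
have := evolves_le evolves_cos_gap t0; rewrite lerD2l lerN2.
have lt0 : cos r < cos `|s 0 - sb|.
  by rewrite ltr_cos ?in_itv /= ?normr_ge0 ?ltW //= (lt_trans ur).
move=> L; apply/eqP => E; have : cos (s 0 - sb) <= cos (s t - sb).
  apply: L => x /andP[x0 xt].
  rewrite mulr_le0_ge0 ?sqr_ge0 // mulr_ge0_le0 //.
    by rewrite divr_ge0 // ltW // p0 // ltW.
  apply/ltW/basin_cos; first exact: ltW.
  by move=> y /andP[y0 yx]; apply: ux; rewrite y0 (le_trans yx) // ltW.
by rewrite -cos_norm -[cos (s t - sb)]cos_norm E leNgt lt0.
Qed.
Lemma basin_sign t : 0 <= t -> k * sin sb * cos (d t) < 0.
Proof.
by move=> t0; apply: basin_cos => // x /andP[x0 _]; exact/ltW/basin_trap.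
Qed.

(** With [V = 1 - cos u], one has [sin u ^+ 2 = V * (1 + cos u)], and [cos u >= cos r > -1] in the
    basin. Hence [V' <= - c * V], so [V * expR (c * t)] does not increase from its initial value,
    which is at most [2]. *)
Lemma basin_decay : exists2 c, 0 < c &
  forall t, 0 <= t -> 1 - cos (s t - sb) <= 2 * expR (- (c * t)).
Proof.
case: (H) => p0 _ es _; have pp0 := p0 0 (lexx _).
have r0 : 0 < r by exact: le_lt_trans ur.
have Rm0 : 0 < Rm by rewrite mulr_gt0 // expR_gt0.
have q1 : 0 < 1 - q by rewrite subr_gt0.
have cr : 0 < 1 + cos r.
  rewrite -ltrBlDl sub0r -cospi ltr_cos // in_itv /= ?pi_ge0 ?lexx //.
  by rewrite (ltW r0) ltW.
(* Product of uniform lower bounds for the three factors of the decay rate, proved below as [pR],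
   [kc] and [cux]. *)
pose c := 2 / Rm * (`|k| * (1 - q)) * (1 + cos r).
have c0 : 0 < c by rewrite !mulr_gt0 // ?invr_gt0 // normr_gt0.
exists c => // t t0.
have := evolvesM evolves_cos_gap (evolves_expR (evolvesZ c evolves_id)).
move=> /evolves_le/(_ t0); rewrite mulr0 expR0 !mulr1.
have c2 : 1 - cos (s 0 - sb) <= 2 by have := cos_geN1 (s 0 - sb); lra.
rewrite expRN ler_pdivlMr ?expR_gt0 // => L.
rewrite (le_trans _ c2) //; apply: L => x /andP[x0 _].
set V := 1 - cos (s x - sb).
have V0 : 0 <= V by rewrite subr_ge0 cos_le1.
have x0' := ltW x0; have ux := basin_trap x0'.
have sinV : sin (s x - sb) ^+ 2 = V * (1 + cos (s x - sb)).
  by rewrite sin2cos2 /V; ring.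
have cux : 1 + cos r <= 1 + cos (s x - sb).
  by rewrite lerD2l cos_norm_le // ltW.
(* Here [sin sb] has modulus [1], and [1 - q <= cos (d x) ^+ 2], which is at most the modulus of
   [cos (d x)]. *)
have kc : `|k| * (1 - q) <= - (k * sin sb * cos (d x)).
  have := basin_sign x0'; have := basin_cos2 x0' (ltW ux) => h1 h2.
  rewrite -(ltr0_norm h2) !normrM.
  have -> : `|sin sb| = 1.
    by apply/eqP; rewrite norm_sin_eq1 csb.
  rewrite mulr1 ler_wpM2l // (le_trans h1) // -real_normK ?num_real // expr2.
  by rewrite ler_piMl // cos_max.
have pR : 2 / Rm <= 2 / p x.
  rewrite ler_wpM2l // lef_pV2 ?posrE // ?p0 //.
  exact: basin_rho x0' (ltW ux).
have le_c : c <= 2 / p x * - (k * sin sb * cos (d x)) * (1 + cos (s x - sb)).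
  have P0 : 0 <= 2 / Rm by rewrite divr_ge0 // ltW.
  have K0 : 0 <= `|k| * (1 - q) by rewrite mulr_ge0 // ltW.
  by apply: ler_pM => //; [exact: mulr_ge0 | exact: ler_pM].
rewrite sinV [leLHS](_ : _ = V * expR (c * x) *
  (c - 2 / p x * - (k * sin sb * cos (d x)) * (1 + cos (s x - sb)))); last by ring.
by rewrite mulr_ge0_le0 ?subr_le0 // mulr_ge0 // expR_ge0.
Qed.

(** The cosine of the deviation tends to [1], and trapping below [r < pi] excludes the nonzero
    multiples of [2 * pi]. Capping the tolerance by [r] keeps it where the cosine decreases. *)
Lemma basin_cvg : (s t - sb) @[t --> +oo] --> (0 : R).
Proof.
have [c c0 dec] := basin_decay.
have r0 : 0 < r by exact: le_lt_trans ur.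
apply/cvgrPdist_lt => e e0; pose e1 := Num.min e r.
have e10 : 0 < e1 by rewrite lt_min e0.
have e1pi : e1 <= pi by rewrite ge_min (ltW rpi) orbT.
have g0 : 0 < 1 - cos e1.
  by rewrite subr_gt0 -cos0 ltr_cos // in_itv /= ?lexx ?pi_ge0 // (ltW e10).
near=> t.
have t0 : 0 <= t by near: t; exact: nbhs_pinfty_ge.
rewrite sub0r normrN ltNge; apply/negP => ue.
have : 1 - cos e1 <= 2 * expR (- (c * t)).
  apply: le_trans (dec t t0); rewrite lerD2l lerN2 -(cos_norm (s t - sb)).
  rewrite cos_norm_le ?normr_ge0 //; last first.
    by rewrite (le_trans (ltW (basin_trap t0))) // ltW.
  by rewrite gtr0_norm // (le_trans _ ue) // ge_min lexx.
rewrite leNgt expRN ltr_pdivrMr ?expR_gt0 // => /negP; apply.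
(* The bound [1 + y <= expR y] turns exponential decay into a linear condition on [t]. *)
have /lt_le_trans : 2 / (1 - cos e1) < 1 + c * t.
  rewrite (@lt_trans _ _ (c * t)) ?ltrDr // [c * t]mulrC -ltr_pdivrMr //.
  by near: t; apply: nbhs_pinfty_gt; exact: num_real.
move=> /(_ _ (expR_ge1Dx _)).
by rewrite ltr_pdivrMr // mulrC.
Unshelve. all: by end_near. Qed.

End Basin.
End Reduced.

(** * Existence of solutions of the reduced system *)

Section Existence.
Context {R : realType}.
Variables v k : R.
Hypotheses (v0 : 0 < v) (k0 : k != 0).

(* [tan (u / 2) = c * exp (- z)] turns [u' = - a u * sin u] into an equation
   [z' = a (u z)] whose right-hand side is bounded away from [0], so that the
   equilibrium [u = 0] is pushed to infinity. *)
Lemma pendulum_exists (a : R -> R) (u0 m M : R) : continuous a -> 0 < m ->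
  `|u0| < pi -> (forall u, `|u| <= `|u0| -> m <= a u <= M) ->
  exists u : R -> R, [/\ u 0 = u0, forall t, 0 <= t -> `|u t| <= `|u0| &
    evolves u (fun t => - a (u t) * sin (u t))].
Proof.
move=> ca m0 u0pi amM.
pose c := tan (u0 / 2); pose w (z : R) := c * expR (- 1 * z).
pose U z := 2 * atan (w z).
have U0 : U 0 = u0.
  rewrite /U /w mulr0 expR0 mulr1 /c tanK; first by rewrite mulrC divfK.
  move: u0pi; rewrite ltr_norml => /andP[h1 h2].
  by rewrite in_itv /=; apply/andP; split; lra.
have Ule z : 0 <= z -> `|U z| <= `|u0|.
  move=> z0; rewrite -U0 /U !normrM ler_wpM2l //.
  have atan_norm x : `|atan x| = atan `|x| :> R.
    case: (lerP 0 x) => [x0|/ltW x0].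
      by rewrite !ger0_norm // -atan0 le_atan.
    by rewrite !ler0_norm ?atanN // -atan0 le_atan.
  rewrite !atan_norm le_atan // /w !normrM mulr0 expR0 normr1 ler_wpM2l //.
  by rewrite ger0_norm ?expR_ge0 // -[leRHS]expR0 ler_expR mulN1r oppr_le0.
(* The bounds on [a] hold along [U] for nonnegative arguments only; the absolute value makes them
   global and disappears at the end because [z t >= 0]. *)
have cU : continuous (fun z : R => a (U `|z|)).
  move=> z. apply: (@continuous_comp _ _ _ (fun z => U `|z|) a); last exact: ca.
  apply: (@continuous_comp _ _ _ (fun z : R => `|z|) U); first exact: norm_continuous.
  apply: cvgM; first exact: cvg_cst.
  apply: (@continuous_comp _ _ _ w atan); last exact: continuous_atan.
  apply: cvgM; first exact: cvg_cst.
  apply: (@continuous_comp _ _ _ (fun z : R => -1 * z) expR); last exact: continuous_expR.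
  by apply: cvgM; [exact: cvg_cst | exact: cvg_id].
have [z z0 hz] := scalar_ode cU m0 (fun z => amM _ (Ule _ (normr_ge0 z))).
exists (fun t => U (z t)); split; first by rewrite z0.
  by move=> t /hz[/Ule].
have ez : evolves z (fun t => a (U `|z t|)).
  by apply: evolves_derive => t /hz[].
have ew := evolvesZ c (evolves_expR (evolvesZ (-1) ez)).
have := evolvesZ 2 (evolves_comp ew (dh := fun x => (1 + x ^+ 2)^-1)
  (fun t _ => is_derive1_atan _)).
move=> /evolves_eq; apply=> // t /ltW t0 /=.
have [zt _] := hz _ t0; rewrite ger0_norm // [in RHS]/U sin_mul2atan -/(w _).
by rewrite /w; field; rewrite gt_eqF // ltr_wpDr // sqr_ge0.
Qed.

(** The conserved quantities express [p] and [sin d] through [u = s - sb], and the sign of [cos d]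
    is constant. What remains is a scalar pendulum equation for [u], from which [p], [s] and [d] are
    rebuilt. *)
Lemma pursuit_exists (p0 s0 d0 sb r : R) : 0 < p0 -> cos sb = 0 ->
  `|s0 - sb| < r -> r < pi -> k * sin sb * cos d0 < 0 ->
  sin d0 ^+ 2 * expR (4 * r * (v / `|k|)) < 1 ->
  exists p s d, [/\ pursuit v k p s d, p 0 = p0, s 0 = s0 & d 0 = d0].
Proof.
move=> pp0 csb ur rpi ksd dr.
set q := _ * expR _ in dr.
have r0 : 0 < r by exact: le_lt_trans ur.
pose u0 := s0 - sb; pose e := Num.sg (cos d0).
have cd0 : cos d0 != 0 by apply: contraTneq ksd => ->; rewrite mulr0 ltxx.
have e2 : e * e = 1 by rewrite -expr2 sqr_sg cd0.
pose kap := - (2 * k * e * sin sb).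
have kap0 : 0 < kap.
  have : 0 < - (k * sin sb * cos d0) by rewrite oppr_gt0.
  rewrite [cos d0]numEsg -/e => h.
  have nc : 0 < `|cos d0| by rewrite normr_gt0.
  by rewrite -(pmulr_lgt0 _ nc) /kap; lra.
pose g u := expR (v / k * (u - u0)).
pose w u := sin d0 * g u.
(* Obtained by putting [p = p0 * g u] and [cos d = e * Num.sqrt (1 - w u ^+ 2)] into the equation
   for [u], read as [u' = - a u * sin u]. *)
pose a u := kap * Num.sqrt (1 - w u ^+ 2) / (p0 * g u).
pose G := expR (2 * r * (v / `|k|)).
have g0 u : 0 < g u by exact: expR_gt0.
have gG u : `|u| <= r -> G^-1 <= g u <= G.
  move=> ule; rewrite -expRN !ler_expR -ler_norml normrM normf_div (gtr0_norm v0).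
  rewrite mulrC ler_wpM2r ?divr_ge0 // ?(ltW v0) //.
  by rewrite (le_trans (ler_normB _ _)) // mulr_natl mulr2n lerD // ltW.
have G0 : 0 < G by exact: expR_gt0.
have wq u : `|u| <= r -> w u ^+ 2 <= q.
  move=> /gG/andP[_ gu]; rewrite /w exprMn ler_wpM2l ?sqr_ge0 //.
  have -> : 4 * r * (v / `|k|) = 2 * r * (v / `|k|) + 2 * r * (v / `|k|) by ring.
  by rewrite expRD -expr2 lerXn2r // nnegrE ltW.
have q1 : 0 < 1 - q by rewrite subr_gt0.
have cg : continuous g.
  move=> u; apply: (@continuous_comp _ _ _ (fun u => v / k * (u - u0)) expR);
    last exact: continuous_expR.
  by apply: cvgM; [exact: cvg_cst | apply: cvgB; [exact: cvg_id | exact: cvg_cst]].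
have ca : continuous a.
  move=> u; apply: cvgM.
    apply: cvgM; first exact: cvg_cst.
    apply: (@continuous_comp _ _ _ (fun u => 1 - w u ^+ 2) Num.sqrt);
      last exact: sqrt_continuous.
    apply: cvgB; first exact: cvg_cst.
    by rewrite expr2; apply: cvgM; apply: cvgM; (exact: cvg_cst || exact: cg).
  apply: cvgV; first by rewrite mulf_neq0 ?gt_eqF.
  by apply: cvgM; [exact: cvg_cst | exact: cg].
have s1 u : `|u| <= r -> Num.sqrt (1 - q) <= Num.sqrt (1 - w u ^+ 2) <= 1.
  move=> /wq wu; apply/andP; split; first by rewrite ler_wsqrtr // lerD2l lerN2.
  by rewrite -[leRHS]sqrtr1 ler_wsqrtr // lerBlDr lerDl sqr_ge0.
have [] := @pendulum_exists a u0 (kap * Num.sqrt (1 - q) / (p0 * G))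
   (kap * 1 / (p0 * G^-1)) ca.
- by rewrite divr_gt0 ?mulr_gt0 // sqrtr_gt0.
- exact: lt_trans ur rpi.
- move=> u /le_trans/(_ (ltW ur)) ur'.
  have /andP[g1 g2] := gG _ ur'; have /andP[h1 h2] := s1 _ ur'.
  have k0' := ltW kap0; have pp0' := ltW pp0; have G0' := ltW G0.
  rewrite /a; apply/andP; split.
    apply: ler_pM.
    + by rewrite mulr_ge0 // sqrtr_ge0.
    + by rewrite invr_ge0 mulr_ge0.
    + by rewrite ler_wpM2l.
    + by rewrite lef_pV2 ?posrE ?mulr_gt0 // ler_wpM2l.
  apply: ler_pM.
  + by rewrite mulr_ge0 // sqrtr_ge0.
  + by rewrite invr_ge0 mulr_ge0 // ltW.
  + by rewrite ler_wpM2l.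
  + by rewrite lef_pV2 ?posrE ?mulr_gt0 ?invr_gt0 // ler_wpM2l.
move=> u [uz ule eu].
have ur' t : 0 <= t -> `|u t| <= r by move=> /ule/le_trans; apply; exact: ltW.
pose al := asin (sin d0).
have sal : sin al = sin d0 by rewrite asinK // in_itv /= sin_geN1 sin_le1.
have cal : cos al = e * cos d0.
  rewrite cos_asin ?sin_geN1 ?sin_le1 // -cos2sin2 sqrtr_sqr.
  by rewrite [in RHS](numEsg (cos d0)) mulrA e2 mul1r.
have w1 t : 0 <= t -> -1 < w (u t) < 1.
  move=> /ur'/wq h; rewrite -ltr_norml -(@ltr_pXn2r _ 2) ?nnegrE //.
  by rewrite real_normK ?num_real // expr1n (le_lt_trans h).
pose p t := p0 * g (u t); pose s t := u t + sb.
(* The branch of the inverse sine through [d0]: where [cos d0 < 0] it runs opposite to [asin], hence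
   the sign [e]. *)
pose d t := d0 + e * (asin (w (u t)) - al).
have sinE t : sin (e * t) = e * sin t by rewrite sin_sg.
have cosE t : cos (e * t) = cos t by rewrite cos_sg.
have asin_w t : 0 <= t -> sin (asin (w (u t))) = w (u t) /\
    cos (asin (w (u t))) = Num.sqrt (1 - w (u t) ^+ 2).
  move=> /w1/andP[/ltW h1 /ltW h2].
  by rewrite asinK ?in_itv /= ?h1 // cos_asin ?h1.
have cs := cos2Dsin2 d0.
have sind t : 0 <= t -> sin (d t) = w (u t).
  move=> /asin_w[+ _]; rewrite /d sinD sinE cosE cosB sinB sal cal.
  set W := w _; set al' := asin W => ->.
  transitivity (W * (e * e * cos d0 ^+ 2 + sin d0 ^+ 2)); first by ring.
  by rewrite e2 mul1r cs mulr1.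
have cosd t : 0 <= t -> cos (d t) = e * Num.sqrt (1 - w (u t) ^+ 2).
  move=> /asin_w[+ <-]; rewrite /d cosD sinE cosE cosB sinB sal cal.
  set W := w _; set al' := asin W => ->.
  transitivity (e * cos al' * (cos d0 ^+ 2 + sin d0 ^+ 2) +
    W * sin d0 * cos d0 * (1 - e * e)); first by ring.
  by rewrite e2 cs subrr mulr0 mulr1 addr0.
have coss t : cos (s t) = - sin sb * sin (u t).
  by rewrite /s cosD csb mulr0 sub0r mulrC mulNr.
have pos t : 0 < p t by rewrite mulr_gt0.
have eg := evolves_expR (evolvesZ (v / k) (evolvesDc (- u0) eu)).
have ew : evolves (fun t => w (u t)) _ := evolvesZ (sin d0) eg.
exists p, s, d; split; first split.
- by [].
- apply: evolves_eq (evolvesZ p0 eg) _ _ => // t /ltW t0.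
  rewrite coss cosd // -/(g (u t)) /a -/(p t) /kap /p.
  by field; rewrite k0 !gt_eqF.
- apply: evolves_eq (evolvesDc sb eu) _ _ => // t /ltW t0.
  by rewrite coss cosd // /a -/(p t) /kap; field; rewrite gt_eqF.
- have ea := evolves_comp ew (dh := fun x => (Num.sqrt (1 - x ^+ 2))^-1)
    (fun t t0 => is_derive1_asin (w1 t t0)).
  have := evolvesDc d0 (evolvesZ e (evolvesDc (- al) ea)).
  move=> /evolves_eq; apply=> [t _|t /ltW t0]; first by rewrite /d addrC.
  rewrite coss sind // -/(g (u t)) /a -/(p t).
  have S0 : 0 < Num.sqrt (1 - w (u t) ^+ 2).
    have /andP[+ _] := s1 _ (ur' _ t0).
    by apply: lt_le_trans; rewrite sqrtr_gt0.
  rewrite /p in pos *.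
  transitivity ((e * e) * (2 * v / (p0 * g (u t)) * sin sb * sin (u t) * w (u t))).
    rewrite /kap [X in _ = _ * (_ * X)]/w; field.
    by rewrite k0 !gt_eqF.
  by rewrite e2; ring.
- by rewrite /p uz /g subrr mulr0 expR0 mulr1.
- by rewrite /s uz /u0 subrK.
- by rewrite /d uz /w /g subrr mulr0 expR0 mulr1 /al subrr mulr0 addr0.
Qed.

End Existence.

(** * States of two unicycles *)

Section MatrixContinuity.

Lemma within_continuous_mx (T : topologicalType) (K : topologicalType) (m n : nat)
    (D : set T) (f : T -> 'M[K]_(m, n)) :
  (forall i j, {within D, continuous (fun t => f t i j)}) ->
  {within D, continuous f}.
Proof.
move=> cf; apply/subspace_continuousP => t Dt A [P hP sPA].
have H : \forall s \near within D (nbhs t), forall i j, P i j (f s i j).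
  apply: filter_forall => i; apply: filter_forall => j.
  move/subspace_continuousP : (cf i j) => /(_ t Dt); apply; exact: hP.
by apply: filterS H => s; exact: sPA.
Qed.

End MatrixContinuity.

Section TwoUnicycles.
Context {R : realType}.
Implicit Types (x y : state R 2) (v k t : R).

Lemma ord2P (P : 'I_2 -> Prop) : P 0 -> P 1 -> forall i, P i.
Proof.
move=> P0 P1 [[|[|//]] h].
  by rewrite (_ : Ordinal h = 0) //; exact: val_inj.
by rewrite (_ : Ordinal h = 1) //; exact: val_inj.
Qed.

Lemma ord3P (P : 'I_3 -> Prop) : P 0 -> P 1 -> P 2 -> forall i, P i.
Proof.
move=> P0 P1 P2 [[|[|[|//]]] h].
- by rewrite (_ : Ordinal h = 0) //; exact: val_inj.
- by rewrite (_ : Ordinal h = 1) //; exact: val_inj.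
- by rewrite (_ : Ordinal h = 2) //; exact: val_inj.
Qed.

Lemma sum2E (F : 'I_2 -> R) : \sum_(i < 2) F i = F 0 + F 1.
Proof. by rewrite big_ord_recr big_ord1 /=; congr (F _ + F _); exact: val_inj. Qed.

Lemma sum3E (F : 'I_3 -> R) : \sum_(i < 3) F i = F 0 + F 1 + F 2.
Proof.
rewrite big_ord_recr big_ord_recr big_ord1 /=.
by congr (F _ + F _ + F _); exact: val_inj.
Qed.

Lemma ordS2_0 : ordS (0 : 'I_2) = 1. Proof. exact: val_inj. Qed.
Lemma ordS2_1 : ordS (1 : 'I_2) = 0. Proof. exact: val_inj. Qed.

Lemma gamma2_0 x : gamma x 0 = 0.
Proof. by rewrite /gamma mul0r big_pred0 ?subr0. Qed.

Lemma gamma2_1 x : gamma x 1 = pi - beta x 0.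
Proof. by rewrite /gamma mul1r big_mkcond sum2E /= addr0. Qed.

(* The closure constraint is [gcos x + i gsin x = 0]; along solutions this complex
   number satisfies [z' = - i omega_1 z], hence has constant modulus. *)
Definition gsin x := rho x 0 * sin (alpha x 0) - rho x 1 * sin (alpha x 1 - beta x 0).
Definition gcos x := rho x 0 * cos (alpha x 0) - rho x 1 * cos (alpha x 1 - beta x 0).

Lemma gsinE x : \sum_(i < 2) rho x i * sin (alpha x i + gamma x i) = gsin x.
Proof.
rewrite sum2E gamma2_0 gamma2_1 addr0 [alpha x 1 + _]addrCA [pi + _]addrC.
by rewrite sinDpi /gsin mulrN.
Qed.

Lemma gcosE x : \sum_(i < 2) rho x i * cos (alpha x i + gamma x i) = gcos x.
Proof.
rewrite sum2E gamma2_0 gamma2_1 addr0 [alpha x 1 + _]addrCA [pi + _]addrC.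
by rewrite cosDpi /gcos mulrN.
Qed.

Lemma eqmod2pi_refl (a : R) : eqmod2pi a a.
Proof. by exists 0; rewrite subrr mul0r. Qed.

Lemma eqmod2piD (a b c d : R) : eqmod2pi a b -> eqmod2pi c d ->
  eqmod2pi (a + c) (b + d).
Proof. by move=> [m em] [n en]; exists (m + n); rewrite intrD mulrDl -em -en; ring. Qed.

Lemma eqmod2piN (a b : R) : eqmod2pi a b -> eqmod2pi (- a) (- b).
Proof. by move=> [m em]; exists (- m); rewrite intrN mulNr -em; ring. Qed.

(** The closure constraint equates two complex numbers in polar form: comparing squared moduli gives
    equal distances, and then the cosine of the difference of arguments is [1]. For two vehicles the
    term [n * pi] is a full turn. *)
Lemma manifold2P x : manifold x <->
  [/\ 0 < rho x 0, rho x 1 = rho x 0,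
      eqmod2pi (alpha x 1) (alpha x 0 + beta x 0) &
      eqmod2pi (beta x 0 + beta x 1) 0].
Proof.
rewrite /manifold /= gsinE gcosE /gsin /gcos sum2E.
have two_pi : eqmod2pi (2 * pi : R) 0 by exists 1; rewrite subr0 mul1r.
split=> [[r0 /eqP es /eqP ec eb]|[r0 r1 ea eb]].
  move: es ec; rewrite !subr_eq0 => /eqP es /eqP ec.
  have r01 := r0 0; have r11 := r0 1.
  have rr : rho x 1 = rho x 0.
    have : rho x 1 ^+ 2 = rho x 0 ^+ 2.
      rewrite -[LHS]mulr1 -[RHS]mulr1 -{1}(cos2Dsin2 (alpha x 1 - beta x 0)).
      by rewrite -(cos2Dsin2 (alpha x 0)) !mulrDr -!exprMn es ec.
    by move/eqP; rewrite eqrXn2 ?ltW // => /eqP.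
  split=> //.
    apply: cos_eq1_eqmod2pi.
    move: es ec; rewrite rr => /(mulfI _) -/(_ (lt0r_neq0 r01)) es.
    move=> /(mulfI _) -/(_ (lt0r_neq0 r01)) ec.
    rewrite opprD addrA addrAC cosB es ec -!expr2.
    exact: cos2Dsin2.
  have := eqmod2piD eb (eqmod2piN two_pi).
  by rewrite oppr0 !addr0 addrK.
have es := eqmod2pi_sin (eqmod2piD ea (eqmod2pi_refl (- beta x 0))).
have ec := eqmod2pi_cos (eqmod2piD ea (eqmod2pi_refl (- beta x 0))).
rewrite addrK in es ec; split.
- by apply: ord2P; rewrite ?r1.
- by rewrite es r1 subrr.
- by rewrite ec r1 subrr.
- by have := eqmod2piD eb two_pi; rewrite addr0.
Qed.

(** * Invariance of the constraint manifold *)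

Section Solution.
Variables (v k : R) (xi : R -> state R 2).
Hypothesis sol : is_solution v k xi.

Lemma evolves_coord (f : state R 2 -> 'I_2 -> R) (df : state R 2 -> 'I_2 -> R)
    (j : 'I_3) i : (forall x i, f x i = x i j) ->
  (forall t, 0 < t -> is_derive t (1 : R) (fun s => f (xi s) i) (df (xi t) i)) ->
  evolves (fun t => f (xi t) i) (fun t => df (xi t) i).
Proof.
move=> fE hd; split=> //; case: sol => _ cxi _.
have -> : (fun t => f (xi t) i) = (fun t => xi t i j) by apply/funext => t.
move/subspace_continuousP : cxi => cxi; apply/subspace_continuousP => t t0.
exact: (cvg_comp _ _ (cxi t t0) (@coord_continuous _ _ _ i j (xi t))).
Qed.

Lemma evolves_rho i : evolves (fun t => rho (xi t) i) (fun t => rho_rhs v (xi t) i).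
Proof. by apply: (@evolves_coord _ _ 0) => // t; case: sol => _ _ h /(h _ i)[]. Qed.

Lemma evolves_alpha i :
  evolves (fun t => alpha (xi t) i) (fun t => alpha_rhs v k (xi t) i).
Proof. by apply: (@evolves_coord _ _ 1) => // t; case: sol => _ _ h /(h _ i)[]. Qed.

Lemma evolves_beta i :
  evolves (fun t => beta (xi t) i) (fun t => beta_rhs v k (xi t) i).
Proof. by apply: (@evolves_coord _ _ 2) => // t; case: sol => _ _ h /(h _ i)[]. Qed.

Lemma solution_manifold t : manifold (xi 0) -> 0 <= t -> manifold (xi t).
Proof.
move=> M0 t0; have r0 s i : 0 <= s -> 0 < rho (xi s) i by case: sol => r0 _ _; exact: r0.
have eb s : 0 <= s -> beta (xi s) 0 + beta (xi s) 1 = beta (xi 0) 0 + beta (xi 0) 1.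
  move=> s0; apply: (evolves_const (evolvesD (evolves_beta 0) (evolves_beta 1))) => //.
  by move=> x _; rewrite /beta_rhs ordS2_0 ordS2_1; ring.
have [_ _ _ b0] := (manifold2P _).1 M0.
(* The sum of the two [beta] is conserved and a multiple of [2 * pi], so [beta] of the second
   vehicle may be replaced by minus that of the first inside [sin] and [cos]. *)
have cs s : 0 <= s ->
  [/\ cos (alpha (xi s) 1 + beta (xi s) 1) = cos (alpha (xi s) 1 - beta (xi s) 0)
    & sin (alpha (xi s) 1 + beta (xi s) 1) = sin (alpha (xi s) 1 - beta (xi s) 0)].
  move=> /eb es; have : eqmod2pi (beta (xi s) 1) (- beta (xi s) 0).
    have := eqmod2piD b0 (eqmod2pi_refl (- beta (xi s) 0)).
    by rewrite add0r -es addrAC subrr add0r.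
  move=> /(eqmod2piD (eqmod2pi_refl (alpha (xi s) 1))) h.
  by split; [exact: eqmod2pi_cos | exact: eqmod2pi_sin].
have ea1 := evolvesD (evolves_alpha 1) (evolvesZ (-1) (evolves_beta 0)).
have ea0 := evolves_alpha 0.
have eS := evolvesD (evolvesM (evolves_rho 0) (evolves_sin ea0))
  (evolvesZ (-1) (evolvesM (evolves_rho 1) (evolves_sin ea1))).
have eC := evolvesD (evolvesM (evolves_rho 0) (evolves_cos ea0))
  (evolvesZ (-1) (evolvesM (evolves_rho 1) (evolves_cos ea1))).
have dS : evolves (fun t => gsin (xi t)) (fun t => - omega v k (xi t) 0 * gcos (xi t)).
  apply: evolves_eq eS _ _ => [s _|s s0]; first by rewrite /gsin !mulN1r.
  have [cE sE] := cs _ (ltW s0).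
  have p0 := r0 s 0 (ltW s0); have p1 := r0 s 1 (ltW s0).
  rewrite /gcos /rho_rhs /alpha_rhs /beta_rhs ordS2_0 /omega /cos_sum cE sE !mulN1r.
  set A := alpha (xi s) 0; set B := beta (xi s) 0.
  have -> : alpha (xi s) 1 = (alpha (xi s) 1 - B) + B by rewrite subrK.
  set F := alpha (xi s) 1 - B; rewrite addrK.
  have hA := cos2Dsin2 A; have hF := cos2Dsin2 F.
  rewrite (cosD A B) (cosD F B) (sinD A B) (sinD F B).
  apply/eqP; rewrite -subr_eq0; apply/eqP.
  (* The two sides agree only modulo the Pythagorean identities for [A] and [F]; this is their
     difference as an explicit multiple of those. *)
  transitivity ((v * sin B) * (cos A ^+ 2 + sin A ^+ 2 - (cos F ^+ 2 + sin F ^+ 2))).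
    by field; rewrite !gt_eqF.
  by rewrite hA hF subrr mulr0.
have dC : evolves (fun t => gcos (xi t)) (fun t => omega v k (xi t) 0 * gsin (xi t)).
  apply: evolves_eq eC _ _ => [s _|s s0]; first by rewrite /gcos !mulN1r.
  have [cE sE] := cs _ (ltW s0).
  have p0 := r0 s 0 (ltW s0); have p1 := r0 s 1 (ltW s0).
  rewrite /gsin /rho_rhs /alpha_rhs /beta_rhs ordS2_0 /omega /cos_sum cE sE !mulN1r.
  set A := alpha (xi s) 0; set B := beta (xi s) 0.
  have -> : alpha (xi s) 1 = (alpha (xi s) 1 - B) + B by rewrite subrK.
  set F := alpha (xi s) 1 - B; rewrite addrK.
  have hA := cos2Dsin2 A; have hF := cos2Dsin2 F.
  rewrite (cosD A B) (cosD F B) (sinD A B) (sinD F B).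
  apply/eqP; rewrite -subr_eq0; apply/eqP.
  transitivity ((- v - v * cos B) *
    (cos A ^+ 2 + sin A ^+ 2 - (cos F ^+ 2 + sin F ^+ 2))).
    by field; rewrite !gt_eqF.
  by rewrite hA hF subrr mulr0.
have eN := evolvesD (evolvesM dS dS) (evolvesM dC dC).
have : gsin (xi t) * gsin (xi t) + gcos (xi t) * gcos (xi t) =
       gsin (xi 0) * gsin (xi 0) + gcos (xi 0) * gcos (xi 0).
  by apply: (evolves_const eN t0) => s _; ring.
case: M0 => _; rewrite gsinE gcosE => -> -> bM.
rewrite !mul0r addr0 -!expr2 => /eqP.
rewrite paddr_eq0 ?sqr_ge0 // !sqrf_eq0 => /andP[/eqP gS /eqP gC].
split; rewrite ?gsinE ?gcosE //; first by move=> i; exact: r0.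
by move: bM; rewrite !sum2E eb.
Qed.

End Solution.
End TwoUnicycles.

(** * Passage between the closed loop and the reduced system *)

Section Reduction.
Context {R : realType}.
Implicit Types (x y : state R 2) (v k t s d p c : R).

Definition sigma x := alpha x 0 + beta x 0 / 2.
Definition delta x := - (beta x 0 / 2).

Lemma alpha0E x : alpha x 0 = sigma x + delta x.
Proof. by rewrite /sigma /delta addrK. Qed.

Lemma alphabeta0E x : alpha x 0 + beta x 0 = sigma x - delta x.
Proof. by rewrite /sigma /delta; lra. Qed.

(** The second vehicle has the same sigma and the opposite delta, modulo full turns. *)
Lemma manifold_partner x : manifold x -> [/\ rho x 1 = rho x 0,
  eqmod2pi (alpha x 1) (sigma x - delta x) &
  eqmod2pi (alpha x 1 + beta x 1) (sigma x + delta x)].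
Proof.
move=> /manifold2P[_ r1 ea eb]; rewrite -alphabeta0E; split=> //.
have := eqmod2piD (eqmod2piD ea eb) (eqmod2pi_refl (- beta x 0)).
by rewrite -alpha0E; congr eqmod2pi; ring.
Qed.

(** Invariance of the manifold expresses the angular speed of the second vehicle through sigma and
    delta of the first, which closes the system. *)
Lemma solution_pursuit v k (xi : R -> state R 2) :
  is_solution v k xi -> manifold (xi 0) ->
  pursuit v k (fun t => rho (xi t) 0) (fun t => sigma (xi t)) (fun t => delta (xi t)).
Proof.
move=> sol M0; have r0 t i : 0 <= t -> 0 < rho (xi t) i.
  by case: sol => h _ _; exact: h.
have er := evolves_rho sol 0; have ea := evolves_alpha sol 0.
have eb := evolves_beta sol 0.
split; first by move=> t; exact: r0.
- apply: evolves_eq er _ _ => // t _.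
  by rewrite /rho_rhs /cos_sum alphabeta0E alpha0E cosD cosB; ring.
- apply: evolves_eq (evolvesD ea (evolvesZ (2^-1) eb)) _ _ => t.
    by rewrite /sigma mulrC.
  move=> /ltW t0; have [r1 a1 b1] := manifold_partner (solution_manifold sol M0 t0).
  have p0 := r0 t 0 t0.
  rewrite /alpha_rhs /beta_rhs ordS2_0 /omega /cos_sum r1.
  rewrite (eqmod2pi_sin a1) (eqmod2pi_cos a1) (eqmod2pi_cos b1) alphabeta0E alpha0E.
  move: (sigma _) (delta _) => S D.
  by rewrite !cosD !sinD !cosN !sinN; field; rewrite gt_eqF.
- apply: evolves_eq (evolvesZ (- 2^-1) eb) _ _ => t.
    by rewrite /delta mulNr mulrC.
  move=> /ltW t0; have [r1 a1 b1] := manifold_partner (solution_manifold sol M0 t0).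
  have p0 := r0 t 0 t0.
  rewrite /alpha_rhs /beta_rhs ordS2_0 /omega /cos_sum r1.
  rewrite (eqmod2pi_sin a1) (eqmod2pi_cos a1) (eqmod2pi_cos b1) alphabeta0E alpha0E.
  move: (sigma _) (delta _) => S D.
  by rewrite !cosD !sinD !cosN !sinN; field; rewrite gt_eqF.
Qed.

Definition mk_state p a0 b0 a1 b1 : state R 2 := \matrix_(i < 2, j < 3)
  if j == 0 then p else if j == 1 then (if i == 0 then a0 else a1)
  else (if i == 0 then b0 else b1).

Lemma mk_stateE p a0 b0 a1 b1 (x := mk_state p a0 b0 a1 b1) :
  ((forall i, rho x i = p) * (alpha x 0 = a0) * (alpha x 1 = a1) *
   (beta x 0 = b0) * (beta x 1 = b1))%type.
Proof. by rewrite /rho /alpha /beta /x; repeat split; intros; rewrite !mxE. Qed.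

Lemma state_eq x y : (forall i, rho x i = rho y i) ->
  (forall i, alpha x i = alpha y i) -> (forall i, beta x i = beta y i) -> x = y.
Proof.
move=> r a b; apply/matrixP => i.
by apply: (@ord3P (fun j => x i j = y i j)); [exact: r | exact: a | exact: b].
Qed.

(** The constants [c0] and [c1] are full turns: the manifold fixes the angles of the second vehicle
    only modulo [2 * pi], and an arbitrary initial state must be matched exactly. *)
Lemma pursuit_solution v k (p s d : R -> R) c0 c1 :
  pursuit v k p s d -> eqmod2pi c0 0 -> eqmod2pi c1 0 ->
  is_solution v k (fun t => mk_state (p t) (s t + d t) (- 2 * d t)
    (s t - d t + c0) (2 * d t + c1)).
Proof.
move=> [p0 ep es ed] e0 e1.
have es0 t : cos (s t - d t + c0) = cos (s t - d t) /\
    sin (s t - d t + c0) = sin (s t - d t).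
  have := eqmod2piD (eqmod2pi_refl (s t - d t)) e0; rewrite addr0 => h.
  by split; [exact: eqmod2pi_cos | exact: eqmod2pi_sin].
have es1 t : cos (s t - d t + c0 + (2 * d t + c1)) = cos (s t + d t) /\
   sin (s t - d t + c0 + (2 * d t + c1)) = sin (s t + d t).
  have := eqmod2piD (eqmod2pi_refl (s t + d t)) (eqmod2piD e0 e1).
  rewrite !addr0 (_ : s t + d t + _ = s t - d t + c0 + (2 * d t + c1)); last by ring.
  by move=> h; split; [exact: eqmod2pi_cos | exact: eqmod2pi_sin].
have eB0 := evolvesZ (-2) ed.
have eA0 := evolvesD es ed.
have eA1 := evolvesDc c0 (evolvesD es (evolvesZ (-1) ed)).
have eB1 := evolvesDc c1 (evolvesZ 2 ed).
have e2 t : s t + d t + -2 * d t = s t - d t by ring.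
set xi := fun t => _.
have [h0 h1 h2 h3] : [/\
   forall i, evolves (fun t => rho (xi t) i) (fun t => rho_rhs v (xi t) i),
   forall i, evolves (fun t => alpha (xi t) i) (fun t => alpha_rhs v k (xi t) i),
   forall i, evolves (fun t => beta (xi t) i) (fun t => beta_rhs v k (xi t) i) &
   forall t i, 0 <= t -> 0 < rho (xi t) i].
  split; last by move=> t i t0; rewrite /xi mk_stateE p0.
  - apply: ord2P; apply: evolves_eq ep _ _ => [t _|t /ltW t0]; rewrite /xi ?mk_stateE //
      /rho_rhs /cos_sum !mk_stateE ?(es0 t).1 ?(es1 t).1 ?e2 !cosD cosN sinN; ring.
  - apply: ord2P.
      apply: evolves_eq eA0 _ _ => [t _|t /ltW t0]; rewrite /xi ?mk_stateE //.
      rewrite /alpha_rhs /cos_sum !mk_stateE ?e2 !cosD !sinD cosN sinN.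
      by field; rewrite gt_eqF ?p0.
    apply: evolves_eq eA1 _ _ => [t _|t /ltW t0]; rewrite /xi ?mk_stateE //.
      by ring.
    rewrite /alpha_rhs /cos_sum !mk_stateE (es0 t).1 (es0 t).2 (es1 t).1 (es1 t).2.
    rewrite !cosD !sinD cosN sinN.
    by field; rewrite gt_eqF ?p0.
  - apply: ord2P.
      apply: evolves_eq eB0 _ _ => [t _|t /ltW t0]; rewrite /xi ?mk_stateE //.
      rewrite /beta_rhs ordS2_0 /omega /cos_sum !mk_stateE (es0 t).1 (es0 t).2 (es1 t).1.
      rewrite ?e2 !cosD !sinD cosN sinN.
      by field; rewrite gt_eqF ?p0.
    apply: evolves_eq eB1 _ _ => [t _|t /ltW t0]; rewrite /xi ?mk_stateE //.
    rewrite /beta_rhs ordS2_1 /omega /cos_sum !mk_stateE (es0 t).1 (es0 t).2 (es1 t).1.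
    rewrite ?e2 !cosD !sinD cosN sinN.
    by field; rewrite gt_eqF ?p0.
split; first by move=> t i; exact: h3.
  2: by move=> t i t0; split; [exact: (h0 i).2 | exact: (h1 i).2 | exact: (h2 i).2].
apply: within_continuous_mx => i.
apply: (@ord3P (fun j => {within `[0, +oo[, continuous (fun t => xi t i j)})).
- exact: (h0 i).1.
- exact: (h1 i).1.
- exact: (h2 i).1.
Qed.

Lemma basin_solution v k x sb r : 0 < v -> k != 0 -> manifold x ->
  cos sb = 0 -> `|sigma x - sb| < r -> r < pi -> k * sin sb * cos (delta x) < 0 ->
  sin (delta x) ^+ 2 * expR (4 * r * (v / `|k|)) < 1 ->
  exists2 xi, is_solution v k xi & xi 0 = x.
Proof.
move=> v0 k0 /manifold2P[r0 r1 ea eb] csb ur rpi ksd dr.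
have [p [s [d [H p0 s0 d0]]]] := pursuit_exists v0 k0 r0 csb ur rpi ksd dr.
pose c0 := alpha x 1 - (alpha x 0 + beta x 0).
pose c1 := beta x 0 + beta x 1.
have e0 : eqmod2pi c0 0.
  have := eqmod2piD ea (eqmod2pi_refl (- (alpha x 0 + beta x 0))).
  by rewrite subrr.
exists (fun t => mk_state (p t) (s t + d t) (- 2 * d t)
    (s t - d t + c0) (2 * d t + c1)); first exact: pursuit_solution.
apply: state_eq; apply: ord2P; rewrite mk_stateE ?p0 ?s0 ?d0 //;
  by rewrite /c0 /c1 /sigma /delta; lra.
Qed.

End Reduction.

(** * Circular formations *)

Section Circular.
Context {R : realType}.
Implicit Types (x y : state R 2) (v k t s u : R).

(** The condition [2 * alpha + beta = pi] reads [cos (2 * sigma) = -1], that is [cos sigma = 0]. *)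
Lemma circular_sigma y s : circular y -> common_s y s ->
  cos (sigma y) = 0 /\ s = sin (sigma y) * cos (delta y) / rho y 0.
Proof.
move=> [[_ e _] _] c.
have cs : cos (sigma y) = 0.
  have := eqmod2pi_cos (e 0); rewrite cospi.
  have -> : 2 * alpha y 0 + beta y 0 = sigma y *+ 2 by rewrite /sigma; lra.
  rewrite cos_mulr2n => h; apply/eqP; rewrite -sqrf_eq0; apply/eqP; lra.
by split=> //; rewrite -(c 0) alpha0E sinD cs mul0r addr0.
Qed.

Lemma circular_intro y : manifold y -> cos (sigma y) = 0 -> cos (delta y) != 0 ->
  circular y /\ common_s y (sin (sigma y) * cos (delta y) / rho y 0).
Proof.
move=> M cs cd; have [r1 a1 b1] := manifold_partner M.
have r0 : 0 < rho y 0 by case: M.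
have cm : common_s y (sin (sigma y) * cos (delta y) / rho y 0).
  apply: ord2P; first by rewrite alpha0E sinD cs mul0r addr0.
  by rewrite r1 (eqmod2pi_sin a1) sinB cs mul0r subr0.
split=> //; split; last first.
  exists (sin (sigma y) * cos (delta y) / rho y 0) => //.
  have /eqP s1 : `|sin (sigma y)| == 1 by rewrite norm_sin_eq1 cs.
  have sn : sin (sigma y) != 0 by rewrite -normr_eq0 s1 oner_eq0.
  by rewrite mulf_neq0 ?invr_eq0 ?(gt_eqF r0) // mulf_neq0.
split=> //; last by exists (sin (sigma y) * cos (delta y) / rho y 0).
have c2 : eqmod2pi (2 * sigma y) pi.
  apply: cos_eq1_eqmod2pi; rewrite cosB cospi sinpi mulr0 addr0 mulr_natl.
  by rewrite cos_mulr2n cs expr0n mul0rn sub0r mulrN1 opprK.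
apply: ord2P; first by rewrite (_ : _ + _ = 2 * sigma y) // /sigma; lra.
(* For the second vehicle delta cancels in [alpha + (alpha + beta)], leaving again [2 * sigma]. *)
have := eqmod2piD (eqmod2piD a1 b1) (eqmod2pi_refl (0 : R)).
rewrite !addr0 (_ : alpha y 1 + _ = 2 * alpha y 1 + beta y 1); last by ring.
rewrite (_ : sigma y - _ + _ = 2 * sigma y); last by ring.
move=> h; have := eqmod2piD h (eqmod2piD c2 (eqmod2piN (eqmod2pi_refl (2 * sigma y)))).
by congr eqmod2pi; ring.
Qed.

Lemma circular_negP k y : circular_neg 2 k y -> [/\ manifold y,
  cos (sigma y) = 0 & k * sin (sigma y) * cos (delta y) < 0].
Proof.
move=> [cy [s cm ks]]; have [cs sE] := circular_sigma cy cm.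
have M : manifold y by case: cy => -[].
split=> //; have r0 : 0 < rho y 0 by case: M.
by move: ks; rewrite sE !mulrA pmulr_llt0 // invr_gt0.
Qed.

Lemma circular_neg_intro k y : manifold y -> cos (sigma y) = 0 ->
  k * sin (sigma y) * cos (delta y) < 0 -> circular_neg 2 k y.
Proof.
move=> M cs ks; have r0 : 0 < rho y 0 by case: M.
have [|cy cm] := circular_intro M cs.
  by apply: contraTneq ks => ->; rewrite mulr0 ltxx.
split=> //; exists (sin (sigma y) * cos (delta y) / rho y 0) => //.
by rewrite !mulrA pmulr_llt0 // invr_gt0.
Qed.

(** For the instability proof: the single coordinate [alpha y 0] bounds the distance to this set
    from below. *)
Lemma circular_pos_sin k y : circular_pos 2 k y -> 0 < k * sin (alpha y 0).
Proof.
move=> [cy [s cm ks]]; have r0 : 0 < rho y 0 by case: cy => -[[]].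
by move: ks; rewrite -(cm 0) mulrA pmulr_lgt0 // invr_gt0.
Qed.

Lemma enorm_ge0 x : 0 <= enorm x. Proof. exact: sqrtr_ge0. Qed.

Lemma entry_le_enorm x i j : `|x i j| <= enorm x.
Proof.
rewrite -sqrtr_sqr /enorm ler_wsqrtr // (bigD1 i) //= (bigD1 j) //= -addrA lerDl.
by rewrite addr_ge0 // sumr_ge0 // => a _; rewrite ?sumr_ge0 // => *; exact: sqr_ge0.
Qed.

Lemma dist_ge0 x (S : set (state R 2)) : 0 <= dist x S.
Proof.
(* The infimum of the empty set is [0] by convention. *)
rewrite /dist; have [->|/set0P S0] := eqVneq [set enorm (x - y) | y in S] set0.
  by rewrite inf0.
by apply: lb_le_inf => // _ [y _ <-]; exact: enorm_ge0.
Qed.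

Lemma dist_le x y (S : set (state R 2)) : S y -> dist x S <= enorm (x - y).
Proof.
move=> Sy; apply: ge_inf; last by exists y.
by exists 0 => _ [z _ <-]; exact: enorm_ge0.
Qed.

Definition shift x u := mk_state (rho x 0) (alpha x 0 - u) (beta x 0)
  (alpha x 1 - u) (beta x 1).

Lemma shift_manifold x u : manifold x -> manifold (shift x u).
Proof.
move=> /manifold2P[r0 r1 ea eb]; apply/manifold2P; rewrite !mk_stateE; split=> //.
by have := eqmod2piD ea (eqmod2pi_refl (- u)); rewrite addrAC.
Qed.

Lemma shift_sigma x u : sigma (shift x u) = sigma x - u.
Proof. by rewrite /sigma !mk_stateE addrAC. Qed.

Lemma shift_delta x u : delta (shift x u) = delta x.
Proof. by rewrite /delta mk_stateE. Qed.

(** Only the two [alpha] entries change, each by [u], so the squared norm is [2 * u ^+ 2]. *)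
Lemma enorm_shift x u : manifold x -> enorm (x - shift x u) <= 2 * `|u|.
Proof.
move=> /manifold2P[_ r1 _ _].
have -> : 2 * `|u| = Num.sqrt ((2 * u) ^+ 2) by rewrite sqrtr_sqr normrM ger0_norm.
rewrite /enorm ler_wsqrtr // sum2E !sum3E !mxE /=.
rewrite -!/(rho _ _) -!/(alpha _ _) -!/(beta _ _).
have h := sqr_ge0 u; rewrite r1 !subKr !subrr expr0n /= exprMn; lra.
Qed.

(** * Convergence of solutions to the stable formations *)

Section Attraction.
Variables (v k : R) (xi : R -> state R 2) (sb r : R).
Hypotheses (v0 : 0 < v) (k0 : k != 0) (sol : is_solution v k xi)
  (M0 : manifold (xi 0)) (csb : cos sb = 0) (ur : `|sigma (xi 0) - sb| < r)
  (rpi : r < pi) (ksd : k * sin sb * cos (delta (xi 0)) < 0)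
  (dr : sin (delta (xi 0)) ^+ 2 * expR (4 * r * (v / `|k|)) < 1).

Let P := solution_pursuit sol M0.

Lemma sigma_cvg : (sigma (xi t) - sb) @[t --> +oo] --> (0 : R).
Proof. exact: (basin_cvg v0 k0 P csb ur rpi ksd dr). Qed.

Lemma attracted : dist (xi t) (circular_neg 2 k) @[t --> +oo] --> (0 : R).
Proof.
have U : (2 * `|sigma (xi t) - sb|) @[t --> +oo] --> (0 : R).
  have -> : (0 : R) = 2 * `|0 : R| by rewrite normr0 mulr0.
  by apply: cvgM; [exact: cvg_cst | apply: cvg_norm; exact: sigma_cvg].
apply: (squeeze_cvgr _ (cvg_cst 0) U); near=> t.
have t0 : 0 <= t by near: t; exact: nbhs_pinfty_ge.
have M := solution_manifold sol M0 t0.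
rewrite dist_ge0 /=; apply: le_trans (enorm_shift (sigma (xi t) - sb) M).
apply: dist_le; apply: circular_neg_intro.
- exact: shift_manifold.
- by rewrite shift_sigma subKr.
- rewrite shift_sigma shift_delta subKr.
  exact: (basin_sign v0 k0 P csb ur rpi ksd dr t0).
Unshelve. all: by end_near. Qed.

End Attraction.

Lemma sigma_near x y : `|sigma x - sigma y| <= 2 * enorm (x - y).
Proof.
have ha := entry_le_enorm (x - y) 0 1; have hb := entry_le_enorm (x - y) 0 2.
rewrite !mxE -!/(alpha _ _) -!/(beta _ _) in ha hb.
rewrite (_ : sigma x - sigma y = alpha x 0 - alpha y 0 + (beta x 0 - beta y 0) / 2).
  rewrite (le_trans (ler_normD _ _)) // normrM [`|2^-1|]ger0_norm //.
  by have := normr_ge0 (beta x 0 - beta y 0); lra.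
by rewrite /sigma; lra.
Qed.

Lemma delta_near x y : `|delta x - delta y| <= enorm (x - y).
Proof.
have hb := entry_le_enorm (x - y) 0 2; rewrite !mxE -!/(beta _ _) in hb.
rewrite (_ : delta x - delta y = - ((beta x 0 - beta y 0) / 2)).
  rewrite normrN normrM [`|2^-1|]ger0_norm //.
  by have := normr_ge0 (beta x 0 - beta y 0); lra.
by rewrite /delta; lra.
Qed.

(** The basin is centred at [sigma y]. As [cos (delta y) != 0], the smallness condition is strict at
    [r = 0], hence holds for some [r > 0]; it and the sign condition then persist for [x] near
    [y]. *)
Lemma circular_neg_stable v k : 0 < v -> k != 0 ->
  locally_asymptotically_stable v k (circular_neg 2 k).
Proof.
move=> v0 k0 y /circular_negP[My cy ksy].
have cd : cos (delta y) != 0 by apply: contraTneq ksy => ->; rewrite mulr0 ltxx.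
have sd : sin (delta y) ^+ 2 < 1.
  by rewrite sin2cos2 ltrBlDr ltrDl lt0r sqrf_eq0 cd sqr_ge0.
pose E (r : R) := expR (4 * r * (v / `|k|)).
have cE : continuous E.
  move=> r; apply: (@continuous_comp _ _ _ (fun r : R => 4 * r * (v / `|k|)) expR);
    last exact: continuous_expR.
  by apply: cvgM; [apply: cvgM; [exact: cvg_cst | exact: cvg_id] | exact: cvg_cst].
have [r [r0 rpi Er]] : exists r : R, [/\ 0 < r, r < pi & sin (delta y) ^+ 2 * E r < 1].
  have : \forall r \near nbhs (0 : R), sin (delta y) ^+ 2 * E r < 1.
    apply: (cvgr_lt (sin (delta y) ^+ 2 * E 0)).
      by apply: cvgM; [exact: cvg_cst | exact: cE].
    by rewrite /E mulr0 mul0r expR0 mulr1.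
  move=> /nbhs_ballP[e /= e0 he]; exists (Num.min (e / 2) 1).
  have m0 : 0 < Num.min (e / 2) 1 by rewrite lt_min divr_gt0 /=.
  split=> //; first by have := pi_ge2 R; rewrite gt_min => ?; apply/orP; right; lra.
  apply: he; rewrite /ball /= sub0r normrN gtr0_norm // gt_min; apply/orP; left.
  by lra.
have : \forall d \near nbhs (delta y), sin d ^+ 2 * E r < 1 /\
    k * sin (sigma y) * cos d < 0.
  apply: filterI.
    have : (sin d ^+ 2 * E r) @[d --> delta y] --> sin (delta y) ^+ 2 * E r.
      apply: cvgM; last exact: cvg_cst.
      by rewrite expr2; apply: cvgM; exact: continuous_sin.
    by move=> /cvgr_lt; apply.
  have : (k * sin (sigma y) * cos d) @[d --> delta y] -->
      k * sin (sigma y) * cos (delta y).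
    by apply: cvgM; [exact: cvg_cst | exact: continuous_cos].
  by move=> /cvgr_lt; apply.
move=> /nbhs_ballP[e /= e0 he].
(* Half of [r] compensates the factor [2] in [sigma_near]. *)
exists (Num.min e (r / 2)); first by rewrite lt_min e0 divr_gt0.
move=> x Mx; rewrite lt_min => /andP[xe xr].
have [d1 d2] : sin (delta x) ^+ 2 * E r < 1 /\ k * sin (sigma y) * cos (delta x) < 0.
  by apply: he; rewrite /ball /= distrC (le_lt_trans (delta_near _ _)).
have ux : `|sigma x - sigma y| < r by have := sigma_near x y; lra.
split; first exact: (@basin_solution R v k x (sigma y) r).
move=> xi sol xi0; apply: (@attracted v k xi (sigma y) r) => //; by rewrite xi0.
Qed.

Lemma circular_pos_unstable v k : 0 < v -> k != 0 ->
  unstable v k (circular_pos 2 k).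
Proof.
move=> v0 k0 stab.
(* Tolerance [1/2]: [e * sin (alpha _ 0)] is positive on the unstable set but ends below [-1/2]
   along the solution, and [sin] is 1-Lipschitz. *)
have half0 : 0 < 2^-1 :> R by rewrite invr_gt0.
pose e := Num.sg k.
have ke : k * e = `|k| by rewrite normrEsg mulrC.
have e1 : `|e| = 1 by rewrite normr_sg k0.
have nk : 0 < `|k| by rewrite normr_gt0.
(* Symmetric states with delta [0]: the smallness condition then holds for every [r]. *)
pose sym a := mk_state 1 a 0 a 0 : state R 2.
have symM a : manifold (sym a).
  apply/manifold2P; rewrite !mk_stateE !addr0; split=> //; exact: eqmod2pi_refl.
have syms a : sigma (sym a) = a by rewrite /sigma !mk_stateE mul0r addr0.
have symd a : delta (sym a) = 0 by rewrite /delta !mk_stateE mul0r oppr0.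
pose sp := e * (pi / 2).
have csp : cos sp = 0 by rewrite cos_sg // cos_pihalf.
have ssp : sin sp = e by rewrite sin_sg sin_pihalf mulr1.
have yC : circular_pos 2 k (sym sp).
  have [||cy cm] := circular_intro (symM sp); rewrite ?syms ?symd ?cos0 ?oner_eq0 //.
  split=> //; exists (e * 1 / 1); first by move: cm; rewrite syms symd cos0 ssp mk_stateE.
  by rewrite !mulr1 divr1 ke.
have [dl dl0 stable] := stab _ half0 _ yC.
(* The shift by [h] moves the state by at most [2 * h < dl], and [h <= 1] keeps [pi - h]
   positive. *)
pose h := Num.min (dl / 4) 1.
have h0 : 0 < h by rewrite lt_min divr_gt0 /=.
have hd : h <= dl / 4 by rewrite ge_min lexx.
have h1 : h <= 1 by rewrite ge_min lexx orbT.
pose x := sym (sp - e * h).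
have near_x : enorm (x - sym sp) < dl.
  have -> : sym sp = shift x (- (e * h)).
    apply: state_eq; apply: ord2P; rewrite !mk_stateE //; lra.
  rewrite (le_lt_trans (enorm_shift _ (symM _))) // normrN normrM e1 mul1r.
  by rewrite gtr0_norm //; lra.
(* The stable angle lies at distance [pi] from [sp], so the start is at distance [pi - h] from it,
   and [r] is chosen strictly between [pi - h] and [pi]. *)
pose sb := - sp; pose r := pi - h / 2.
have csb : cos sb = 0 by rewrite cosN.
have pi2 := pi_ge2 R.
have ur : `|sigma x - sb| < r.
  rewrite syms /sb /sp /r (_ : _ - _ - _ = e * (pi - h)); last by lra.
  rewrite normrM e1 mul1r gtr0_norm; lra.
have rpi : r < pi by rewrite /r; lra.
have ksd : k * sin sb * cos (delta x) < 0.
  by rewrite symd cos0 mulr1 sinN ssp mulrN ke oppr_lt0.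
have dr : sin (delta x) ^+ 2 * expR (4 * r * (v / `|k|)) < 1.
  by rewrite symd sin0 expr0n mul0r.
have [xi sol xi0] : exists2 xi, is_solution v k xi & xi 0 = x.
  exact: (basin_solution v0 k0 (symM _) csb ur rpi ksd dr).
rewrite -xi0 in ur ksd dr; have Mx : manifold (xi 0) by rewrite xi0; exact: symM.
have P := solution_pursuit sol Mx.
have cvgs := sigma_cvg v0 k0 sol Mx csb ur rpi ksd dr.
have sd0 t : 0 <= t -> sin (delta (xi t)) = 0.
  move=> t0; have := pursuit_sin P t0; rewrite xi0 symd sin0 mul0r mk_stateE mulr1.
  by [].
(* The contradiction is derived at all sufficiently large times, where sigma is within [1/2] of
   [sb]. *)
have : \forall t \near (+oo : set_system R), False; last by move=> /filter_ex[].
near=> t.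
have t0 : 0 <= t by near: t; exact: nbhs_pinfty_ge.
have lt2 : dist (xi t) (circular_pos 2 k) < 2^-1.
  exact: (stable x (symM _) near_x xi sol xi0 t t0).
have us : `|sigma (xi t) - sb| < 2^-1.
  by rewrite -normrN -[X in `|X|]add0r; near: t;
    move/cvgrPdist_lt : cvgs; apply; rewrite invr_gt0.
have kc := basin_sign v0 k0 P csb ur rpi ksd dr t0.
move: lt2; rewrite ltNge => /negP; apply.
(* A member of the set is exhibited, as a lower bound passes to the infimum only for a nonempty
   set. *)
apply: lb_le_inf; first by exists (enorm (xi t - sym sp)); exists (sym sp).
move=> _ [z zC <-].
have cd1 : cos (delta (xi t)) = 1.
  move: kc; rewrite sinN ssp mulrN ke mulNr oppr_lt0 pmulr_rgt0 // => cp.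
  by have := sin0cos1 (sd0 t t0); rewrite gtr0_norm.
have sa : e * sin (alpha (xi t) 0) < - 2^-1.
  rewrite alpha0E sinD sd0 // mulr0 addr0 cd1 mulr1.
  have := le_lt_trans (sin_lipschitz (sigma (xi t)) sb) us.
  rewrite sinN ssp opprK => lt_half.
  have := ler_norm (e * (sin (sigma (xi t)) + e)); rewrite normrM e1 mul1r mulrDr.
  have -> : e * e = 1 by rewrite -expr2 sqr_sg k0.
  by lra.
have sz : 0 < e * sin (alpha z 0).
  have := circular_pos_sin zC; rewrite [X in X * sin _](_ : k = `|k| * e).
    by rewrite -mulrA (pmulr_rgt0 _ nk).
  by rewrite mulrC -numEsg.
have ha := entry_le_enorm (xi t - z) 0 1; rewrite !mxE -!/(alpha _ _) in ha.
apply: le_trans ha; apply: le_trans (sin_lipschitz _ _).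
have := ler_norm (e * (sin (alpha z 0) - sin (alpha (xi t) 0))).
by rewrite normrM e1 mul1r mulrBr distrC; lra.
Unshelve. all: by end_near. Qed.

Lemma rotation_lt0 k : k < 0 ->
  @counterclockwise R 2 = circular_neg 2 k /\ @clockwise R 2 = circular_pos 2 k.
Proof.
move=> k0; split; apply/seteqP; split=> x [cx [s cm s0]]; split=> //; exists s => //.
- by rewrite nmulr_rlt0.
- by rewrite -(nmulr_rlt0 _ k0).
- by rewrite nmulr_rgt0.
- by rewrite -(nmulr_rgt0 _ k0).
Qed.

Lemma rotation_gt0 k : 0 < k ->
  @counterclockwise R 2 = circular_pos 2 k /\ @clockwise R 2 = circular_neg 2 k.
Proof.
move=> k0; split; apply/seteqP; split=> x [cx [s cm s0]]; split=> //; exists s => //.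
- by rewrite pmulr_rgt0.
- by rewrite -(pmulr_rgt0 _ k0).
- by rewrite pmulr_rlt0.
- by rewrite -(pmulr_rlt0 _ k0).
Qed.

End Circular.

Theorem theorem20 (R : realType) (v k : R) (hv : 0 < v) (hk : k != 0) :
  [/\ locally_asymptotically_stable v k (circular_neg 2 k),
      unstable v k (circular_pos 2 k),
      k < 0 -> locally_asymptotically_stable v k (@counterclockwise R 2) /\
               unstable v k (@clockwise R 2) &
      0 < k -> unstable v k (@counterclockwise R 2) /\
               locally_asymptotically_stable v k (@clockwise R 2)].
Proof.
have S := circular_neg_stable hv hk; have U := circular_pos_unstable hv hk.
by split=> // k0; [have [-> ->] := rotation_lt0 k0 | have [-> ->] := rotation_gt0 k0].
Qed.
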